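(* There are absolute constants $C, c > 0$ such that the following holds. Let $n, m \ge 1$ be integers, let $0 < \delta_1 \leq 1/2$ and $0 < \delta, \delta_2 \leq 1$, and suppose that $$m \ge Cn \quad\text{and}\quad m \geq C\left(n\log(m/n) + \log(1/\delta)\right).$$ Let $a_1,\ldots,a_m$ be sampling vectors drawn independently and uniformly from the unit sphere $S^{n-1}$. Then with probability at least $1-\delta$ (over the choice of $a_1,\dots,a_m$), the sampling vectors have the following property: for every signal vector $x \in \mathbb{R}^n$, every initial estimate $x_0\in\mathbb{R}^n$ satisfying $\|x_0-x\|_2 \leq c\sqrt{\delta_1}\,\|x\|_2$, every $\epsilon > 0$, and every nonnegative integer $$K \geq 2\left(\log(1/\epsilon) + \log(2/\delta_2)\right)n,$$ the $K$-th step randomized Kaczmarz estimate $x_K$ (started from $x_0$) satisfies $\|x_K-x\|_2^2 \leq \epsilon \|x_0 - x\|_2^2$ with probability at least $1-\delta_1-\delta_2$ (over the random choice of equations in the algorithm).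
   Context: Phase retrieval: given unit sampling vectors $a_1,\dots,a_m\in S^{n-1}\subset\mathbb{R}^n$ and measurements $b_i = |\langle a_i, x\rangle|$, recover the signal $x\in\mathbb{R}^n$. Randomized Kaczmarz for phase retrieval: starting from $x_0\in\mathbb{R}^n$, at each step $k=1,2,\dots$ choose an index $r(k)\in\{1,\dots,m\}$ uniformly at random, independently of the previous choices, and set $$x_k := x_{k-1} + \eta_k a_{r(k)},\qquad \eta_k = \operatorname{sign}(\langle a_{r(k)},x_{k-1}\rangle)\, b_{r(k)} - \langle a_{r(k)},x_{k-1}\rangle.$$ Here $\operatorname{sign}$ is the usual sign function. An absolute constant does not depend on any parameter. *)

(* Defs.v *)
From HB Require Import structures.
From mathcomp Require Import all_boot all_order all_algebra.
From mathcomp Require Import all_classical all_reals all_analysis.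

Set Implicit Arguments.
Unset Strict Implicit.
Unset Printing Implicit Defensive.

Import Order.TTheory GRing.Theory Num.Theory.
Import numFieldNormedType.Exports.

Local Open Scope classical_set_scope.
Local Open Scope ring_scope.

Definition dotv (R : realType) (n : nat) (u v : 'rV[R]_n) : R :=
  \sum_(i < n) u 0 i * v 0 i.

(* The library's norm `|x| on row vectors is the sup norm. *)
Definition norm2 (R : realType) (n : nat) (v : 'rV[R]_n) : R :=
  Num.sqrt (\sum_(i < n) v 0 i ^+ 2).

Definition borelRV (R : realType) (n : nat) :=
  g_sigma_algebraType (@open 'rV[R]_n).

Definition unit_sphere (R : realType) (n : nat) : set 'rV[R]_n :=
  [set v | norm2 v = 1].

(* The uniform distribution on the unit sphere is the unique Borel probability
   measure carried by the sphere and invariant under the orthogonal group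
   (the full group, so that for n = 1 it is the fair measure on {-1, 1}). *)
Definition uniform_on_sphere (R : realType) (n : nat)
    (mu : probability (borelRV R n) R) : Prop :=
  mu (@unit_sphere R n) = 1%E /\
  forall Q : 'M[R]_n, Q *m Q^T = 1%:M ->
  forall B : set (borelRV R n), measurable B ->
    mu ((fun v : 'rV[R]_n => v *m Q) @^-1` B) = mu B.

(* Mutual independence of the maps X i, where G is the sigma-algebra of their
   common codomain: the product rule holds for every finite subfamily. *)
Definition mutually_independent (d : measure_display) (T : measurableType d)
    (R : realType) (P : probability T R) (I : eqType) (U : Type)
    (G : set (set U)) (X : I -> T -> U) : Prop :=
  forall (s : seq I) (B : I -> set U), uniq s -> (forall i, G (B i)) ->
    P (\big[setI/setT]_(i <- s) (X i @^-1` B i)) =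
    (\prod_(i <- s) P (X i @^-1` B i))%E.

(* 'I_m carries the discrete sigma-algebra, i.e. all its subsets. *)
Definition iid_uniform_indices (d : measure_display) (T : measurableType d)
    (R : realType) (P : probability T R) (m : nat) (r : nat -> T -> 'I_m)
    : Prop :=
  [/\ forall k i, measurable (r k @^-1` [set i]),
      forall k i, P (r k @^-1` [set i]) = (m%:R^-1)%:E &
      mutually_independent P [set: set 'I_m] r].

Definition kaczmarz_step (R : realType) (n : nat) (a : 'rV[R]_n) (b : R)
    (y : 'rV[R]_n) : 'rV[R]_n :=
  y + (Num.sg (dotv a y) * b - dotv a y) *: a.

(* Iterations are numbered from 1 and the sequence r from 0: the equation used
   at step k.+1 is the one of index r k. *)
Fixpoint kaczmarz (R : realType) (n m : nat) (a : 'I_m -> 'rV[R]_n)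
    (b : 'I_m -> R) (r : nat -> 'I_m) (x0 : 'rV[R]_n) (k : nat) : 'rV[R]_n :=
  if k is j.+1
  then kaczmarz_step (a (r j)) (b (r j)) (kaczmarz a b r x0 j)
  else x0.

(* Main.v *)
Require Import Defs.
From HB Require Import structures.
From mathcomp Require Import all_boot all_order all_algebra.
From mathcomp Require Import all_classical all_reals all_analysis.
From mathcomp Require Import measurable_realfun ring lra.
Set Implicit Arguments.
Unset Strict Implicit.
Unset Printing Implicit Defensive.

Import Order.TTheory GRing.Theory Num.Theory.
Import numFieldNormedType.Exports.
Local Open Scope classical_set_scope.
Local Open Scope ring_scope.

(** Why the algorithm converges. Let [z] be the current error and [x] the signal. A
    step along the unit vector [a] removes [dotv a z ^+ 2] from the squared error,
    and adds back at most [4 * dotv a x ^+ 2] if the sign of [dotv a x] has been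
    guessed wrongly, which forces [`|dotv a x| <= `|dotv a z|]
    ([kaczmarz_step_error]). Averaged over the equations the first term is about
    [dotv z z / n]. If the ratio of the lengths of [z] and [x] is a small constant,
    the second is a small fraction of it: either the component along [z] is
    atypically large, or the component along [x] is atypically small, and both are
    rare. So the mean squared error contracts by [1 - 1 / (2 * n)] as long as [z]
    stays in a ball around [x] ([kaczmarz_contraction]), and one induction bounds
    the probability of leaving this ball together with that of converging too
    slowly ([kaczmarz_success]).

    What is required of the sampling vectors is therefore a lower bound for the sum
    of [gain] and an upper bound for the sum of [tent], uniformly in one direction
    each. Both functions vary slowly, so that it suffices to have the bounds on a
    finite net of exponential size ([exists_net], [locally_lipschitz_net]). On the
    net they follow from the Chernoff inequality for independent samples
    ([sample_concentration]) and a union bound.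

    The Chernoff inequality needs three facts on the marginals of the uniform
    distribution, all derived from orthogonal invariance alone. Averaging the
    direction over sign vectors gives a sub-Gaussian tail
    ([mean_expR_marginal], [mean_expR_sqr]); rotating by 45 degrees computes the
    second and fourth moments ([mean_marginal_sqr], [mean_marginal4]); and
    averaging the direction over points of the moment curve bounds the probability
    of small components ([mean_tent]). *)

(** * Inner products and one step of the algorithm *)

Section Dotv.
Context {R : realType} {n : nat}.
Implicit Types (u v w a x y : 'rV[R]_n) (c : R).

Lemma dotvC u v : dotv u v = dotv v u.
Proof. by apply: eq_bigr => i _; rewrite mulrC. Qed.

Lemma dotvDr u v w : dotv u (v + w) = dotv u v + dotv u w.
Proof. by rewrite -big_split; apply: eq_bigr => i _; rewrite mxE mulrDr. Qed.

Lemma dotvZr u c v : dotv u (c *: v) = c * dotv u v.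
Proof. by rewrite mulr_sumr; apply: eq_bigr => i _; rewrite mxE mulrCA. Qed.

Lemma dotvNr u v : dotv u (- v) = - dotv u v.
Proof. by rewrite -scaleN1r dotvZr mulN1r. Qed.

Lemma dotvBr u v w : dotv u (v - w) = dotv u v - dotv u w.
Proof. by rewrite dotvDr dotvNr. Qed.

Lemma dotv0r u : dotv u 0 = 0.
Proof. by rewrite -(scale0r 0) dotvZr mul0r. Qed.

Lemma dotvDl u v w : dotv (u + v) w = dotv u w + dotv v w.
Proof. by rewrite dotvC dotvDr !(dotvC w). Qed.

Lemma dotvZl c u v : dotv (c *: u) v = c * dotv u v.
Proof. by rewrite dotvC dotvZr dotvC. Qed.

Lemma dotvBl u v w : dotv (u - v) w = dotv u w - dotv v w.
Proof. by rewrite dotvC dotvBr !(dotvC w). Qed.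

Lemma dotv_ge0 u : 0 <= dotv u u.
Proof. by apply: sumr_ge0 => i _; rewrite -expr2 sqr_ge0. Qed.

Lemma dotv_eq0 u : (dotv u u == 0) = (u == 0).
Proof.
apply/eqP/eqP => [h|->]; last exact: dotv0r.
apply/rowP => i; rewrite mxE; apply/eqP; rewrite -sqrf_eq0.
rewrite eq_le sqr_ge0 andbT -h /dotv (bigD1 i) //= expr2 lerDl.
by apply: sumr_ge0 => j _; rewrite -expr2 sqr_ge0.
Qed.

Lemma dotv_gt0 u : (0 < dotv u u) = (u != 0).
Proof. by rewrite lt_def dotv_eq0 dotv_ge0 andbT. Qed.

Lemma sqr_norm2 u : norm2 u ^+ 2 = dotv u u.
Proof. by rewrite sqr_sqrtr //; apply: sumr_ge0 => i _; rewrite sqr_ge0. Qed.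

Lemma norm2_ge0 u : 0 <= norm2 u.
Proof. exact: sqrtr_ge0. Qed.

Lemma norm2_eq1 u : (norm2 u = 1) <-> (dotv u u = 1).
Proof.
rewrite -sqr_norm2; split=> [->|/eqP]; first by rewrite expr1n.
by rewrite sqrf_eq1 => /orP[/eqP//|/eqP h]; have := norm2_ge0 u; rewrite h; lra.
Qed.

Lemma sqr_dotv_le a v : dotv a a = 1 -> dotv a v ^+ 2 <= dotv v v.
Proof.
move=> a1; have := dotv_ge0 (v - dotv a v *: a).
rewrite !(dotvBl, dotvBr) !(dotvZl, dotvZr) a1 (dotvC v a); lra.
Qed.

End Dotv.

(** A wrong sign for [p], read off the perturbed value [p + q], requires
    [`|p| <= `|q|], and then the signed value is off by [2 * `|p|]. *)
Lemma sign_error_le (R : realType) (p q : R) :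
  (Num.sg (p + q) * `|p| - p) ^+ 2 <= if `|p| <= `|q| then 4 * p ^+ 2 else 0.
Proof.
case: ifPn => [_|].
  have h : `|Num.sg (p + q) * `|p| - p| <= 2 * `|p|.
    rewrite (le_trans (ler_normB _ _))// normrM normr_id mulr_natl mulr2n lerD2r.
    by rewrite ler_piMl// normr_sg; case: (_ != 0).
  rewrite -real_normK ?num_real// -(real_normK (num_real p)).
  by have := normr_ge0 (Num.sg (p + q) * `|p| - p); nra.
rewrite -ltNge => h.
suff -> : Num.sg (p + q) * `|p| - p = 0 by rewrite expr0n.
case: (ltrgt0P p) h => hp; rewrite ltr_norml => /andP[h1 h2].
- by rewrite gtr0_sg ?mul1r ?subrr//; lra.
- by rewrite ltr0_sg; [ring|lra].
- by rewrite hp; ring.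
Qed.

(** With the right sign the step is the orthogonal projection onto the hyperplane
    through [x] normal to [a], which gives the first two terms by Pythagoras. With
    a wrong sign it ends on another hyperplane normal to [a], at distance at most
    [2 * `|dotv a x|] from the right one. *)
Lemma kaczmarz_step_error (R : realType) (n : nat) (a x y : 'rV[R]_n) :
  dotv a a = 1 ->
  let y' := kaczmarz_step a `|dotv a x| y in
  dotv (y' - x) (y' - x) <= dotv (y - x) (y - x) - dotv a (y - x) ^+ 2
    + (if `|dotv a x| <= `|dotv a (y - x)| then 4 * dotv a x ^+ 2 else 0).
Proof.
move=> a1 /=; set z := y - x; rewrite /kaczmarz_step.
have -> : dotv a y = dotv a x + dotv a z by rewrite -dotvDr addrC subrK.
set e := _ * _ - _; have -> : y + e *: a - x = z + e *: a by rewrite addrAC.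
clearbody z; have := sign_error_le (dotv a x) (dotv a z).
rewrite !(dotvDl, dotvDr) !(dotvZl, dotvZr) a1 (dotvC z a).
set t := if _ then _ else _.
have -> : Num.sg (dotv a x + dotv a z) * `|dotv a x| - dotv a x = e + dotv a z.
  rewrite /e; ring.
lra.
Qed.

Lemma kaczmarz_step_fix (R : realType) (n : nat) (a x : 'rV[R]_n) :
  kaczmarz_step a `|dotv a x| x = x.
Proof. by rewrite /kaczmarz_step -numEsg subrr scale0r addr0. Qed.

Lemma kaczmarz_fix (R : realType) (n m : nat) (a : 'I_m -> 'rV[R]_n) x r K :
  kaczmarz a (fun i => `|dotv (a i) x|) r x K = x.
Proof. by elim: K => //= K ->; rewrite kaczmarz_step_fix. Qed.

Lemma kaczmarzSl (R : realType) (n m : nat) (a : 'I_m -> 'rV[R]_n) b r y K :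
  kaczmarz a b r y K.+1 =
  kaczmarz a b (fun k => r k.+1) (kaczmarz_step (a (r 0%N)) (b (r 0%N)) y) K.
Proof. by elim: K => //= K <-. Qed.

(** * Mean decrease of the error over the equations *)

(** The decrease of the squared error caused by a component [y] of the error is
    [y ^+ 2] when the sign is right and may be as bad as [- (3 * y ^+ 2)] when it is
    wrong. [gain t] lies below the first value everywhere and below the second
    beyond [t], and it is Lipschitz as a function of [y ^+ 2]. *)
Definition gain (R : realType) (t y : R) : R :=
  y ^+ 2 - 8 * Num.max 0 (y ^+ 2 - t ^+ 2 / 2).

(** A Lipschitz majorant of the indicator function of the interval from [- s] to [s]. *)
Definition tent (R : realType) (s y : R) : R := Num.max 0 (2 - `|y| / s).

Section Contraction.
Context (R : realType).
Implicit Types (s t y p q : R).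

Lemma gain_le t y : gain t y <= y ^+ 2.
Proof. by rewrite /gain gerBl mulr_ge0// le_max lexx. Qed.

Lemma gain_le_large t y : 0 <= t -> t <= `|y| -> gain t y <= - (3 * y ^+ 2).
Proof.
move=> t0 ty; have h : t ^+ 2 <= y ^+ 2.
  by rewrite -(real_normK (num_real y)) ler_sqr ?nnegrE.
rewrite /gain; have : y ^+ 2 - t ^+ 2 / 2 <= Num.max 0 (y ^+ 2 - t ^+ 2 / 2).
  by rewrite le_max lexx orbT.
lra.
Qed.

Lemma tent_ge0 s y : 0 <= tent s y.
Proof. by rewrite le_max lexx. Qed.

Lemma tent_ge1 s y : 0 < s -> `|y| <= s -> 1 <= tent s y.
Proof.
move=> s0 ys; rewrite le_max; apply/orP; right.
have : `|y| / s <= 1 by rewrite ler_pdivrMr// mul1r.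
lra.
Qed.

(** Here [q] and [p] are the components of the error and of the signal along a
    sampling vector, normalised by the typical size of such components, and [rho] is
    the ratio of the lengths of the error and of the signal. A wrong sign forces
    [`|p| <= rho * `|q|]: either [`|q|] exceeds [t], and [gain] pays for it, or
    [`|p| <= s], and [tent] does. *)
Lemma gain_tent_le s t rho p q : 0 < s -> 0 < t -> 0 <= rho -> rho * t <= s ->
  gain t q - 4 * t ^+ 2 * tent s p <=
  q ^+ 2 - (if `|p| <= rho * `|q| then 4 * (p ^+ 2 / rho ^+ 2) else 0).
Proof.
move=> s0 t0 r0 rs; have b0 := tent_ge0 s p; have t2 : 0 < t ^+ 2 by rewrite exprn_gt0.
case: ifPn => [pq|_]; last first.
  by have := gain_le t q; have := mulr_ge0 (ltW t2) b0; lra.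
have pq2 : p ^+ 2 / rho ^+ 2 <= q ^+ 2.
  have [->|rn0] := eqVneq rho 0; first by rewrite expr0n invr0 mulr0 sqr_ge0.
  have rgt : 0 < rho by rewrite lt_def rn0.
  rewrite ler_pdivrMr ?exprn_gt0// -(real_normK (num_real p)).
  rewrite -(real_normK (num_real q)) mulrC -exprMn ler_sqr ?nnegrE//.
  exact: mulr_ge0.
have [tq|qt] := leP t `|q|.
  by have := gain_le_large (ltW t0) tq; have := mulr_ge0 (ltW t2) b0; lra.
have b1 : 1 <= tent s p.
  apply: tent_ge1 => //; apply: (le_trans pq); apply: le_trans rs.
  by rewrite ler_wpM2l// ltW.
have q2 : q ^+ 2 <= t ^+ 2.
  by rewrite -(real_normK (num_real q)) ler_sqr ?nnegrE//; exact: ltW.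
have := gain_le t q; nra.
Qed.

(** The components of the error and of the signal only enter through sums of [gain]
    and of [tent] along one direction each: the interaction of the two directions,
    that is the wedge where the signs differ, has been decoupled. *)
Lemma kaczmarz_contraction (n m : nat) (a : 'I_m -> 'rV[R]_n) (s t : R) :
  (0 < n)%N -> (0 < m)%N -> 0 < s -> 0 < t ->
  (forall i, dotv (a i) (a i) = 1) ->
  (forall v, dotv v v = 1 ->
     7 / 10 * m%:R <= \sum_(i < m) gain t (Num.sqrt n%:R * dotv (a i) v)) ->
  (forall u, dotv u u = 1 ->
     4 * t ^+ 2 * \sum_(i < m) tent s (Num.sqrt n%:R * dotv (a i) u) <= 2 / 10 * m%:R) ->
  forall x y : 'rV[R]_n, t ^+ 2 * dotv (y - x) (y - x) <= s ^+ 2 * dotv x x -> x != 0 ->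
  \sum_(i < m) dotv (kaczmarz_step (a i) `|dotv (a i) x| y - x)
                    (kaczmarz_step (a i) `|dotv (a i) x| y - x)
    <= m%:R * ((1 - (2 * n%:R)^-1) * dotv (y - x) (y - x)).
Proof.
move=> n0 m0 s0 t0 a1 hgain htent x y hxy xn0.
set V := dotv (y - x) (y - x); have V0 : 0 <= V by exact: dotv_ge0.
have [Vz|Vn0] := eqVneq V 0.
  have yx : y = x by apply/eqP; rewrite -subr_eq0 -dotv_eq0; apply/eqP.
  rewrite Vz !mulr0 big1// => i _.
  by rewrite yx kaczmarz_step_fix subrr dotv0r.
have Vp : 0 < V by rewrite lt_def Vn0.
have xp : 0 < dotv x x by rewrite dotv_gt0.
set Z := Num.sqrt V; set X := Num.sqrt (dotv x x).
have Zp : 0 < Z by rewrite sqrtr_gt0.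
have Xp : 0 < X by rewrite sqrtr_gt0.
have Z2 : Z ^+ 2 = V by rewrite sqr_sqrtr.
have X2 : X ^+ 2 = dotv x x by rewrite sqr_sqrtr// dotv_ge0.
set N := Num.sqrt (n%:R : R); have Np : 0 < N by rewrite sqrtr_gt0 ltr0n.
have N2 : N ^+ 2 = n%:R by rewrite sqr_sqrtr.
have hv := hgain (Z^-1 *: (y - x)).
have hu := htent (X^-1 *: x).
rewrite dotvZl dotvZr -/V -Z2 mulrA -invfM -expr2 mulVf ?expf_neq0 ?gt_eqF// in hv.
rewrite dotvZl dotvZr -X2 mulrA -invfM -expr2 mulVf ?expf_neq0 ?gt_eqF// in hu.
move: (hv erefl) (hu erefl) => {}hv {}hu.
pose q i := N * dotv (a i) (Z^-1 *: (y - x)).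
pose p i := N * dotv (a i) (X^-1 *: x).
have step i : dotv (kaczmarz_step (a i) `|dotv (a i) x| y - x)
                    (kaczmarz_step (a i) `|dotv (a i) x| y - x)
    <= V - V / n%:R * (gain t (q i) - 4 * t ^+ 2 * tent s (p i)).
  apply: le_trans (kaczmarz_step_error _ _ (a1 i)) _.
  rewrite -/V.
  have qE : dotv (a i) (y - x) = Z / N * q i.
    by rewrite /q dotvZr; field; rewrite !gt_eqF.
  have pE : dotv (a i) x = X / N * p i.
    by rewrite /p dotvZr; field; rewrite !gt_eqF.
  have rs : Z / X * t <= s.
    rewrite mulrAC ler_pdivrMr// -ler_sqr ?nnegrE; last 2 first.
    - by apply: mulr_ge0; exact: ltW.
    - by apply: mulr_ge0; exact: ltW.
    by rewrite !exprMn Z2 X2 mulrC.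
  have := gain_tent_le (p i) (q i) s0 t0 (divr_ge0 (ltW Zp) (ltW Xp)) rs.
  have -> : (`|p i| <= Z / X * `|q i|) = (`|dotv (a i) x| <= `|dotv (a i) (y - x)|).
    rewrite qE pE !normrM !normfV (gtr0_norm Zp) (gtr0_norm Xp) (gtr0_norm Np).
    rewrite -(@ler_pM2l _ (X / N)) ?divr_gt0//; congr (_ <= _).
    by field; rewrite !gt_eqF.
  move: (`|dotv (a i) x| <= _) => c; move: (q i) (p i) qE pE => qi pi qE pE h.
  have {}h := ler_wpM2l (divr_ge0 V0 (ler0n R n)) h.
  rewrite -addrA lerD2l lerNr opprD opprK; apply: le_trans h _.
  rewrite qE pE mulrBr !exprMn !exprVn N2 Z2 X2.
  rewrite lerB//.
  case: c; rewrite ?mulr0//.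
  by rewrite le_eqVlt; apply/orP; left; apply/eqP; field; rewrite !gt_eqF ?ltr0n.
apply: le_trans (ler_sum _ (fun i _ => step i)) _.
rewrite sumrB sumr_const card_ord -mulr_sumr sumrB -mulr_sumr.
set G := \sum_(i < m) gain _ _; set S := \sum_(i < m) tent _ _.
have h : 1 / 2 * m%:R <= G - 4 * t ^+ 2 * S.
  rewrite -/N -/q -/G in hv; rewrite -/N -/p -/S in hu; lra.
have := ler_wpM2l (divr_ge0 V0 (ler0n R n)) h.
have nn : (n%:R : R) != 0 by rewrite pnatr_eq0 -lt0n.
have -> : m%:R * ((1 - (2 * n%:R)^-1) * V) = V *+ m - V / n%:R * (1 / 2 * m%:R).
  by rewrite -mulr_natl; field.
lra.
Qed.

End Contraction.

(** * Random indices *)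

Lemma measure_bigsetU_seq_le (d : measure_display) (T : measurableType d)
    (R : realType) (mu : {measure set T -> \bar R}) (I : Type) (s : seq I)
    (A : I -> set T) : (forall i, measurable (A i)) ->
  (mu (\big[setU/set0]_(i <- s) A i) <= \sum_(i <- s) mu (A i))%E.
Proof.
move=> mA; elim: s => [|i s IH]; first by rewrite !big_nil measure0.
rewrite !big_cons (le_trans (measureU2 _ _ _))//; first exact: bigsetU_measurable.
exact: leeD2l.
Qed.

Section RandomIndices.
Context (R : realType) (n m : nat) (a : 'I_m -> 'rV[R]_n) (b : 'I_m -> R).
Context (d : measure_display) (T : measurableType d) (P : probability T R).
Context (r : nat -> T -> 'I_m).
Hypothesis riid : iid_uniform_indices P r.

Let run j w y K := kaczmarz a b (fun k => r (j + k)%N w) y K.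

Let runS j w y K :
  run j w y K.+1 = run j.+1 w (kaczmarz_step (a (r j w)) (b (r j w)) y) K.
Proof.
rewrite /run kaczmarzSl addn0; congr kaczmarz.
by apply/funext => k; rewrite addSnnS.
Qed.

Let measurable_index k (B : set 'I_m) : measurable (r k @^-1` B).
Proof.
have [mr _ _] := riid.
have -> : r k @^-1` B = \big[setU/set0]_(i <- enum 'I_m | `[< B i >]) (r k @^-1` [set i]).
  apply/seteqP; split=> w /=; rewrite -bigcup_seq_cond.
    by move=> Bw; exists (r k w) => //=; rewrite mem_enum /=; apply/asboolP.
  by move=> [i /= /andP[_ /asboolP Bi]] ->.
exact: bigsetU_measurable.
Qed.

Let measurable_run (Q : 'rV[R]_n -> Prop) j y K : measurable [set w | Q (run j w y K)].
Proof.
elim: K j y => [|K IH] j y.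
  have [q|q] := pselect (Q y).
    by rewrite (_ : [set _ | _] = setT)//; apply/seteqP; split.
  by rewrite (_ : [set _ | _] = set0)//; apply/seteqP; split.
rewrite (_ : [set _ | _] = \big[setU/set0]_(i <- enum 'I_m)
   (r j @^-1` [set i] `&` [set w | Q (run j.+1 w (kaczmarz_step (a i) (b i) y) K)])).
  by apply: bigsetU_measurable => i _; exact: measurableI.
rewrite -bigcup_seq; apply/seteqP; split=> w /=; rewrite runS.
  by move=> Qw; exists (r j w) => //=; rewrite mem_enum.
by move=> [i _ [/= ->]].
Qed.

Let cylinder j (s : nat -> 'I_m) : set T :=
  \big[setI/setT]_(k <- iota 0 j) (r k @^-1` [set s k]).

Let measurable_cylinder j s : measurable (cylinder j s).
Proof. exact: bigsetI_measurable. Qed.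

Let probability_cylinder j s : P (cylinder j s) = (m%:R^-1 ^+ j)%:E.
Proof.
have [_ Pr ind] := riid.
rewrite /cylinder ind ?iota_uniq//.
rewrite (eq_bigr (fun=> (m%:R^-1)%:E)); last by move=> k _; rewrite Pr.
by rewrite prodEFin big_const_seq count_predT size_iota iter_mulr_1.
Qed.

(** Conditioning on a cylinder is what makes the induction on [K] work. Averaging
    over the next index multiplies both terms of the bound by at most [1] and [q]
    respectively, by contraction, as long as [V y <= B]; once [V y > B] the first
    term exceeds [1] and there is nothing to prove. Thus the bound itself accounts
    for the trajectories that leave the region of contraction, without any
    stopping time. *)
Let failure_cylinder (x : 'rV[R]_n) (q B t : R) :
  let V y := dotv (y - x) (y - x) in
  (0 < m)%N -> 0 <= q <= 1 -> 0 < B -> 0 < t ->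
  (forall y, V y <= B ->
     \sum_(i < m) V (kaczmarz_step (a i) (b i) y) <= m%:R * (q * V y)) ->
  forall K y j s,
  (P (cylinder j s `&` [set w | (t < V (run j w y K))%R]) <=
     (m%:R^-1 ^+ j * (V y / B + q ^+ K * (V y / t)))%:E)%E.
Proof.
move=> V m0 /andP[q0 q1] B0 t0 contr.
have V0 y : 0 <= V y by exact: dotv_ge0.
have mj j : 0 <= (m%:R^-1 : R) ^+ j by rewrite exprn_ge0// invr_ge0.
have mev K y j s : measurable (cylinder j s `&` [set w | (t < V (run j w y K))%R]).
  by apply: measurableI => //; exact: (measurable_run (fun z => t < V z)).
have triv K y j s : 1 <= V y / B + q ^+ K * (V y / t) ->
  (P (cylinder j s `&` [set w | (t < V (run j w y K))%R]) <=
     (m%:R^-1 ^+ j * (V y / B + q ^+ K * (V y / t)))%:E)%E.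
  move=> h; rewrite (@le_trans _ _ (P (cylinder j s)))//.
    by apply: le_measure; rewrite ?inE.
  by rewrite probability_cylinder lee_fin ler_peMr.
elim=> [|K IH] y j s.
  have [tV|Vt] := orP (le_total t (V y)).
    apply: (triv 0%N y); rewrite expr0 mul1r (@le_trans _ _ (V y / t))//.
      by rewrite ler_pdivlMr// mul1r.
    by rewrite lerDr divr_ge0// ltW.
  rewrite (_ : _ `&` _ = set0); last first.
    by apply/seteqP; split=> // w [_ /=]; rewrite ltNge Vt.
  rewrite measure0 lee_fin mulr_ge0// addr_ge0// ?divr_ge0// ?(ltW B0)//.
  by rewrite mulr_ge0 ?exprn_ge0// divr_ge0// ltW.
have [BV|VB] := orP (le_total B (V y)).
  apply: triv; rewrite (@le_trans _ _ (V y / B))//.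
    by rewrite ler_pdivlMr// mul1r.
  by rewrite lerDl mulr_ge0 ?exprn_ge0// divr_ge0// ltW.
pose s' i k := if k == j then i else s k.
have -> : cylinder j s `&` [set w | (t < V (run j w y K.+1))%R] =
   \big[setU/set0]_(i <- enum 'I_m) (cylinder j.+1 (s' i) `&`
      [set w | (t < V (run j.+1 w (kaczmarz_step (a i) (b i) y) K))%R]).
  have cylS i : cylinder j.+1 (s' i) = cylinder j s `&` (r j @^-1` [set i]).
    rewrite /cylinder -addn1 iotaD big_cat /= big_seq1 /s' add0n eqxx.
    congr (_ `&` _); apply: eq_big_seq => k.
    by rewrite mem_iota add0n /= => kj; rewrite (ltn_eqF kj).
  rewrite -bigcup_seq; apply/seteqP; split=> w /=; rewrite runS.
    by move=> [cw tV]; exists (r j w); rewrite /= ?mem_enum// cylS.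
  by move=> [i _]; rewrite cylS => -[[? /= ->]].
apply: le_trans; first by apply: measure_bigsetU_seq_le => i; exact: mev.
rewrite big_enum.
apply: (@le_trans _ _ (\sum_(i < m) (m%:R^-1 ^+ j.+1 *
   (V (kaczmarz_step (a i) (b i) y) / B +
    q ^+ K * (V (kaczmarz_step (a i) (b i) y) / t)))%:E)%E).
  by apply: lee_sum => i _; exact: IH.
rewrite sumEFin lee_fin -mulr_sumr exprSr -mulrA ler_wpM2l//.
rewrite ler_pdivrMl ?ltr0n// big_split /= -!mulr_suml -mulr_sumr -mulr_suml.
have {contr} := contr y VB; set S := \sum_(i < m) _ => hS.
have h1 : S / B <= m%:R * (V y / B).
  rewrite mulrA ler_wpM2r ?invr_ge0 ?(ltW B0)// (le_trans hS)// ler_wpM2l//.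
  by rewrite ler_piMl.
rewrite mulrDr lerD// exprSr [leRHS](_ : _ = q ^+ K * (m%:R * (q * V y) / t)); last by ring.
by rewrite ler_wpM2l ?exprn_ge0// ler_wpM2r ?invr_ge0// ltW.
Qed.

Lemma kaczmarz_success (x : 'rV[R]_n) (q B t : R) :
  let V y := dotv (y - x) (y - x) in
  (0 < m)%N -> 0 <= q <= 1 -> 0 < B -> 0 < t ->
  (forall y, V y <= B ->
     \sum_(i < m) V (kaczmarz_step (a i) (b i) y) <= m%:R * (q * V y)) ->
  forall K y,
  ((1 - (V y / B + q ^+ K * (V y / t)))%:E <=
    P [set w | (V (kaczmarz a b (fun k => r k w) y K) <= t)%R])%E.
Proof.
move=> V m0 q01 B0 t0 contr K y.
have := failure_cylinder m0 q01 B0 t0 contr K y 0 (fun=> Ordinal m0).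
rewrite /cylinder big_nil setTI expr0 mul1r -/V => hF.
have mF := @measurable_run (fun z => t < V z) 0 y K.
rewrite (_ : [set w | _ <= t] = ~` [set w | t < V (run 0 w y K)]); last first.
  by apply/seteqP; split=> w /=; rewrite ltNge; [move=> ->|move/negP/negPn].
rewrite probability_setC// EFinB leeB//.
Qed.

End RandomIndices.

(** * Passing from a net to the sphere *)

Section NetExtension.
Context {R : realType}.

(** The weight allows quadratic growth, as for [gain]; over the samples it is
    controlled by the quadratic form of the sampling vectors. *)
Definition locally_lipschitz (L : R) (f : R -> R) :=
  forall y y', `|f y - f y'| <= L * (1 + `|y| + `|y'|) * `|y - y'|.

Lemma max0_lipschitz (x y : R) : `|Num.max 0 x - Num.max 0 y| <= `|x - y|.
Proof.
wlog xy : x y / x <= y => [h|].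
  by have [/h//|/ltW/h] := leP x y; rewrite distrC (distrC y).
rewrite (distrC x) (ger0_norm (_ : 0 <= y - x)) ?subr_ge0// distrC.
rewrite /Num.max; case: ifPn => hx; case: ifPn => hy; rewrite ger0_norm; move: hx hy; rewrite -?leNgt; lra.
Qed.

Lemma gain_lipschitz (t : R) : locally_lipschitz 9 (gain t).
Proof.
move=> y y'; rewrite /gain.
have yy : `|y ^+ 2 - y' ^+ 2| <= (1 + `|y| + `|y'|) * `|y - y'|.
  rewrite subr_sqr normrM mulrC ler_wpM2r// (le_trans (ler_normD _ _))// -addrA.
  by rewrite lerDr.
have := max0_lipschitz (y ^+ 2 - t ^+ 2 / 2) (y' ^+ 2 - t ^+ 2 / 2).
rewrite opprB addrA subrK => h.
have -> : y ^+ 2 - 8 * Num.max 0 (y ^+ 2 - t ^+ 2 / 2) -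
    (y' ^+ 2 - 8 * Num.max 0 (y' ^+ 2 - t ^+ 2 / 2)) =
  (y ^+ 2 - y' ^+ 2) - 8 * (Num.max 0 (y ^+ 2 - t ^+ 2 / 2) - Num.max 0 (y' ^+ 2 - t ^+ 2 / 2)) by ring.
rewrite (le_trans (ler_normB _ _))// normrM (ger0_norm (_ : 0 <= 8))//.
by rewrite -mulrA; lra.
Qed.

Lemma tent_lipschitz (s : R) : 0 < s -> locally_lipschitz s^-1 (tent s).
Proof.
move=> s0 y y'; rewrite /tent (le_trans (max0_lipschitz _ _))//.
have -> : 2 - `|y| / s - (2 - `|y'| / s) = s^-1 * (`|y'| - `|y|) by ring.
rewrite normrM gtr0_norm ?invr_gt0// -mulrA ler_wpM2l ?invr_ge0 ?(ltW s0)//.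
rewrite distrC (le_trans (ler_dist_dist _ _))// ler_peMl//.
by rewrite -addrA lerDl addr_ge0.
Qed.

Lemma locally_lipschitzN L (f : R -> R) :
  locally_lipschitz L f -> locally_lipschitz L (fun y => - f y).
Proof. by move=> h y y'; rewrite -opprD normrN. Qed.

Lemma ler_geometric (x A B : R) : (forall k, x <= A + B / 2 ^+ k) -> x <= A.
Proof.
move=> h; rewrite leNgt; apply/negP => Ax.
have e0 : 0 < x - A by rewrite subr_gt0.
have B0 : 0 < B by have := h 0%N; rewrite expr0 divr1; lra.
have := h (Num.bound (B / (x - A))); rewrite -lerBlDl leNgt => /negP; apply.
rewrite ltr_pdivrMr ?exprn_gt0// mulrC -ltr_pdivrMr//.
have := archi_boundP (divr_ge0 (ltW B0) (ltW e0)) => /lt_le_trans; apply.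
by rewrite -natrX ler_nat ltnW// ltn_expl.
Qed.

Context (n m : nat) (a : 'I_m -> 'rV[R]_n).
Hypothesis a_unit : forall i, dotv (a i) (a i) = 1.

Let Y i v := Num.sqrt n%:R * dotv (a i) v.

Definition is_net (e : R) (s : seq 'rV[R]_n) :=
  [/\ forall u, u \in s -> dotv u u = 1 &
      forall v, dotv v v = 1 -> exists2 u, u \in s & dotv (v - u) (v - u) <= e ^+ 2].

Let YB i u v : Y i (u - v) = Y i u - Y i v.
Proof. by rewrite /Y dotvBr mulrBr. Qed.

Let YZ i c v : Y i (c *: v) = c * Y i v.
Proof. by rewrite /Y dotvZr mulrCA. Qed.

(** [Q v <= 2 * Q u + 2 * Q (v - u)] with [u] in the net and [v - u] of length
    at most [1 / 2] turns any bound [B] for the quadratic form [Q] into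
    [4 * m + B / 2], whose iterates decrease to [8 * m]. *)
Lemma quadratic_bound_net s : is_net (1 / 2) s ->
  (forall u, u \in s -> \sum_(i < m) Y i u ^+ 2 <= 2 * m%:R) ->
  forall v, \sum_(i < m) Y i v ^+ 2 <= 8 * m%:R * dotv v v.
Proof.
move=> [su snet] hs v; apply: (@ler_geometric _ _ (n%:R * m%:R * dotv v v)) => k.
elim: k v => [|k IH] v.
  rewrite expr0 divr1 (@le_trans _ _ (n%:R * m%:R * dotv v v))//; last first.
    by rewrite lerDr mulr_ge0 ?mulr_ge0// dotv_ge0.
  rewrite -mulrA mulrCA mulr_natl -[in leRHS](card_ord m) -sumr_const.
  apply: ler_sum => i _; rewrite exprMn sqr_sqrtr// ler_wpM2l//.
  exact: sqr_dotv_le.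
have [->|vn0] := eqVneq v 0.
  by rewrite dotv0r !mulr0 mul0r addr0 big1// => i _; rewrite /Y dotv0r mulr0 expr0n.
have vp : 0 < dotv v v by rewrite dotv_gt0.
set c := Num.sqrt (dotv v v); have c2 : c ^+ 2 = dotv v v by rewrite sqr_sqrtr// ltW.
have c0 : 0 < c by rewrite sqrtr_gt0.
pose v1 := c^-1 *: v.
have v11 : dotv v1 v1 = 1.
  by rewrite dotvZl dotvZr -c2; field; rewrite gt_eqF.
have [u us uv] := snet _ v11.
have h : \sum_(i < m) Y i v1 ^+ 2 <= 8 * m%:R + n%:R * m%:R / 2 ^+ k.+1.
  apply: (@le_trans _ _ (2 * \sum_(i < m) Y i u ^+ 2 + 2 * \sum_(i < m) Y i (v1 - u) ^+ 2)).
    rewrite !mulr_sumr -big_split; apply: ler_sum => i _ /=.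
    rewrite YB; have := sqr_ge0 (Y i u - (Y i v1 - Y i u)); lra.
  have h1 := IH (v1 - u); have h2 := hs _ us.
  have h3 : (8 * m%:R + n%:R * m%:R / 2 ^+ k) * dotv (v1 - u) (v1 - u) <=
            (8 * m%:R + n%:R * m%:R / 2 ^+ k) / 4.
    rewrite ler_wpM2l ?addr_ge0 ?mulr_ge0 ?invr_ge0 ?exprn_ge0//.
    by rewrite (le_trans uv)//; lra.
  have -> : n%:R * m%:R / 2 ^+ k.+1 = n%:R * m%:R / 2 ^+ k / 2 :> R.
    by rewrite exprS invfM; ring.
  rewrite [X in _ <= _ + X]mulrAC -mulrDl in h1; lra.
have -> : \sum_(i < m) Y i v ^+ 2 = dotv v v * \sum_(i < m) Y i v1 ^+ 2.
  rewrite mulr_sumr; apply: eq_bigr => i _; rewrite YZ -c2; field.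
  by rewrite gt_eqF.
by rewrite (le_trans (ler_wpM2l (ltW vp) h))// mulrDr mulrC lerD2l mulrC mulrAC.
Qed.

(** The inequality between arithmetic and geometric means with weight [e] splits
    [(1 + `|p| + `|q|) * `|p - q|] into [e] times a square, whose sum is [O(m)], and
    [e^-1] times [(p - q) ^+ 2], whose sum is [O(e ^+ 2 * m)]. *)
Lemma locally_lipschitz_net (L e : R) f u v : 0 < e -> 0 <= L -> locally_lipschitz L f ->
  (forall w, \sum_(i < m) Y i w ^+ 2 <= 8 * m%:R * dotv w w) ->
  dotv u u = 1 -> dotv v v = 1 -> dotv (v - u) (v - u) <= e ^+ 2 ->
  \sum_(i < m) f (Y i u) - 30 * L * e * m%:R <= \sum_(i < m) f (Y i v).
Proof.
move=> e0 L0 fL hQ u1 v1 uv.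
have m0 : 0 <= (m%:R : R) by [].
have step i : f (Y i u) - f (Y i v) <=
    L * (e / 2 * (3 + 3 * Y i v ^+ 2 + 3 * Y i u ^+ 2) + (2 * e)^-1 * Y i (v - u) ^+ 2).
  rewrite (le_trans (ler_norm _))// distrC (le_trans (fL _ _))// -mulrA ler_wpM2l//.
  rewrite YB -(real_normK (num_real (Y i v - Y i u))).
  rewrite -(real_normK (num_real (Y i v))) -(real_normK (num_real (Y i u))).
  set p := `|Y i v|; set q := `|Y i u|; set w := `|_ - _|.
  have h : (1 + p + q) * w <= e / 2 * (1 + p + q) ^+ 2 + (2 * e)^-1 * w ^+ 2.
    rewrite -subr_ge0 (_ : _ - _ = (2 * e)^-1 * (e * (1 + p + q) - w) ^+ 2).
      by rewrite mulr_ge0 ?sqr_ge0// invr_ge0 mulr_ge0// ltW.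
    by field; rewrite gt_eqF.
  apply: (le_trans h); rewrite lerD2r ler_wpM2l ?divr_ge0 ?(ltW e0)//.
  have := sqr_ge0 (p - 1); have := sqr_ge0 (q - 1); have := sqr_ge0 (p - q); nra.
have := @ler_sum _ _ (index_enum 'I_m) xpredT _ _ (fun i _ => step i).
rewrite sumrB -mulr_sumr big_split /= -!mulr_sumr !big_split /= sumr_const card_ord -!mulr_sumr.
move: (hQ u) (hQ v) (hQ (v - u)); rewrite u1 v1 mulr_natr.
set Qu := \sum_(i < m) Y i u ^+ 2; set Qv := \sum_(i < m) Y i v ^+ 2.
set Qw := \sum_(i < m) Y i _ ^+ 2 => hu hv hw.
have hw' : (2 * e)^-1 * Qw <= 4 * e * m%:R.
  rewrite ler_pdivrMl ?mulr_gt0//; apply: (le_trans hw).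
  by have := ler_wpM2l m0 uv; lra.
have h : e / 2 * (3 *+ m + 3 * Qv + 3 * Qu) + (2 * e)^-1 * Qw <= 30 * e * m%:R.
  have h2 : 3 *+ m + 3 * Qv + 3 * Qu <= 51 * m%:R.
    by rewrite -mulr_natr; move: hu hv; rewrite -mulr_natr; lra.
  have := ler_wpM2l (ltW e0) h2; nra.
have := ler_wpM2l L0 h; lra.
Qed.

End NetExtension.

(** * Nets of the sphere *)

Section Net.
Context (R : realType).

Section LatticePoints.
Context (n L : nat).

Let index := {ffun 'I_n -> bool * 'I_(n * L).+1}.

(** Points of the grid of mesh [(sqrt n * L)^-1], each coordinate being coded by its
    sign and its magnitude. By the Cauchy-Schwarz inequality the unit ball meets
    the grid in points whose magnitudes add up to at most [n * L]. *)
Definition lattice_ball : pred index := fun k => (\sum_i (k i).2 <= n * L)%N.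

Definition lattice_point (k : index) : 'rV[R]_n :=
  \row_i ((-1) ^+ (k i).1 * ((k i).2 : nat)%:R / (Num.sqrt n%:R * L%:R)).

(** Each of the points has weight [2 ^- (sum of the coordinates)], at least
    [2 ^- (n * L)] on the ball, while all weights together form the [n]-th power
    of twice a geometric sum. *)
Lemma card_lattice_ball : (#|lattice_ball| <= (4 * 2 ^ L) ^ n)%N.
Proof.
pose W (j : nat) : R := 2^-1 ^+ j.
have W0 j : 0 < W j by rewrite exprn_gt0 ?invr_gt0.
have geo M : \sum_(j < M) W j <= 2.
  suff -> : \sum_(j < M) W j = 2 - 2 * W M by have := W0 M; lra.
  elim: M => [|M IH]; first by rewrite big_ord0 /W expr0; ring.
  by rewrite big_ord_recr /= IH /W exprS; field.
have total : \sum_(k : index) \prod_i W (k i).2 <= 4 ^+ n.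
  rewrite -(bigA_distr_bigA (fun (_ : 'I_n) (p : bool * 'I_(n * L).+1) => W p.2)) /=.
  rewrite prodr_const card_ord lerXn2r ?nnegrE ?sumr_ge0//.
    by move=> p _; exact: ltW.
  rewrite -(pair_bigA _ (fun (_ : bool) (j : 'I_(n * L).+1) => W j)) /= big_bool /=.
  by have := geo (n * L).+1; lra.
rewrite -(ler_nat R) -(@ler_pM2r _ (W (n * L)%N))//.
rewrite natrX natrM natrX exprMn -exprM (mulnC L) -mulrA -exprMn divff//.
rewrite expr1n mulr1; apply: le_trans total.
rewrite mulr_natl -sumr_const [leRHS](bigID (mem lattice_ball)) /= -[leLHS]addr0.
apply: lerD; last by apply: sumr_ge0 => k _; apply: prodr_ge0 => i _; exact: ltW.
apply: ler_sum => k; rewrite unfold_in => kL.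
by rewrite -expr_sum ler_wiXn2l// ?invr_ge0 ?invf_le1 ?ler1n.
Qed.

(** Rounding every coordinate toward zero moves it by at most [(sqrt n * L)^-1] and
    does not increase the sum of the magnitudes. *)
Lemma lattice_point_dense (v : 'rV[R]_n) : (0 < n)%N -> (0 < L)%N -> dotv v v = 1 ->
  exists2 k, k \in lattice_ball &
    dotv (v - lattice_point k) (v - lattice_point k) <= L%:R^-1 ^+ 2.
Proof.
move=> n0 L0 v1; set N := Num.sqrt (n%:R : R).
have Np : 0 < N by rewrite sqrtr_gt0 ltr0n.
have N2 : N ^+ 2 = n%:R by rewrite sqr_sqrtr.
have Lp : 0 < (L%:R : R) by rewrite ltr0n.
have NL : 0 < N * L%:R by rewrite mulr_gt0.
pose c i := Num.truncn (`|v 0 i| * (N * L%:R)).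
have cle i : (c i)%:R <= `|v 0 i| * (N * L%:R).
  by rewrite truncn_le// mulr_ge0// ltW.
have cgt i : `|v 0 i| * (N * L%:R) < (c i)%:R + 1.
  by rewrite natr1 truncnS_gt.
have csum : (\sum_i c i <= n * L)%N.
  rewrite -(ler_nat R) natr_sum natrM.
  apply: (@le_trans _ _ (\sum_i `|v 0 i| * (N * L%:R))); first exact: ler_sum.
  have h i : `|v 0 i| * (N * L%:R) <= (n%:R * v 0 i ^+ 2 + 1) / 2 * L%:R.
    rewrite mulrA ler_wpM2r// -N2 -(real_normK (num_real (v 0 i))).
    by have := sqr_ge0 (N * `|v 0 i| - 1); lra.
  apply: (le_trans (ler_sum _ (fun i _ => h i))).
  rewrite -mulr_suml ler_wpM2r// -mulr_suml big_split /= -mulr_sumr sumr_const card_ord.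
  have -> : \sum_i v 0 i ^+ 2 = 1 by rewrite -v1; apply: eq_bigr => i _; rewrite expr2.
  by rewrite mulr1; lra.
have cM i : (c i < (n * L).+1)%N.
  by rewrite ltnS (leq_trans _ csum)// (bigD1 i)//= leq_addr.
exists [ffun i => (v 0 i < 0, Ordinal (cM i))].
  by rewrite unfold_in (eq_bigr c) // => i _; rewrite ffunE.
apply: (@le_trans _ _ (\sum_(i < n) (N * L%:R)^-1 ^+ 2)); last first.
  rewrite sumr_const card_ord -[leLHS]mulr_natr invfM exprMn !exprVn N2 mulrAC mulVf ?mul1r//.
  by rewrite pnatr_eq0 -lt0n.
apply: ler_sum => i _; rewrite !mxE ffunE /= -expr2 -real_normK ?num_real//.
rewrite lerXn2r ?nnegrE ?invr_ge0 ?(ltW NL)//.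
rewrite -(ler_pM2r NL) mulVf ?gt_eqF// -[X in _ * X](gtr0_norm NL) -normrM mulrBl.
rewrite divfK ?gt_eqF//.
have := cle i; have := cgt i; have [v0|v0] := ltrP (v 0 i) 0.
  by rewrite (ltr0_norm v0) expr1 ler_norml => ? ?; apply/andP; split; lra.
by rewrite (ger0_norm v0) expr0 ler_norml => ? ?; apply/andP; split; lra.
Qed.

End LatticePoints.

(** Normalising at most doubles the distance to a unit vector, since [u] is the
    point of the sphere nearest to [p]. *)
Lemma normalize_close (n : nat) (v p : 'rV[R]_n) : dotv v v = 1 -> p != 0 ->
  let u := (Num.sqrt (dotv p p))^-1 *: p in
  dotv u u = 1 /\ dotv (v - u) (v - u) <= 4 * dotv (v - p) (v - p).
Proof.
move=> v1 p0 u; set rho := Num.sqrt (dotv p p).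
have pp : 0 < dotv p p by rewrite dotv_gt0.
have r0 : 0 < rho by rewrite sqrtr_gt0.
have r2 : rho ^+ 2 = dotv p p by rewrite sqr_sqrtr// ltW.
have u1 : dotv u u = 1 by rewrite dotvZl dotvZr -/rho -r2; field; rewrite gt_eqF.
have pE : p = rho *: u by rewrite scalerA mulfV ?gt_eqF// scale1r.
split=> //; have := sqr_dotv_le u v1; rewrite u1.
clearbody u rho; rewrite pE; set g := dotv v u => g1.
rewrite !(dotvBl, dotvBr) !(dotvZl, dotvZr) u1 v1 (dotvC u v) -/g.
have [g0|g0] := leP 0 g; first by have := sqr_ge0 (rho - g); nra.
nra.
Qed.

Lemma exists_net (L : nat) : (1 < L)%N -> forall n, (0 < n)%N ->
  exists2 s : seq 'rV[R]_n, (size s <= (4 * 2 ^ L) ^ n)%N & is_net (2 / L%:R) s.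
Proof.
move=> L1 n n0; pose p := @lattice_point n L.
exists [seq (Num.sqrt (dotv (p k) (p k)))^-1 *: p k |
         k <- [seq k <- enum (@lattice_ball n L) | p k != 0]].
  rewrite size_map size_filter (leq_trans (count_size _ _))// -cardE.
  exact: card_lattice_ball.
split=> [u /mapP[k]|v v1].
  rewrite mem_filter => /andP[pk _] ->; set x := _ *: _.
  set r := Num.sqrt (dotv (p k) (p k)).
  have pp : 0 < dotv (p k) (p k) by rewrite dotv_gt0.
  rewrite /x dotvZl dotvZr mulrA -invfM -expr2 sqr_sqrtr ?(ltW pp)//.
  by rewrite mulVf// gt_eqF.
have [k kb hk] := lattice_point_dense n0 (ltnW L1) v1.
have pk0 : p k != 0.
  apply/negP => /eqP pk; move: hk; rewrite -/p pk subr0 v1 leNgt => /negP; apply.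
  by rewrite exprn_ilt1// ?invr_ge0 ?invf_lt1 ?ltr1n ?ltr0n// ltnW.
have [_ h] := normalize_close v1 pk0.
exists ((Num.sqrt (dotv (p k) (p k)))^-1 *: p k).
  by apply/mapP; exists k => //; rewrite mem_filter pk0 mem_enum.
rewrite (le_trans h)// exprMn (_ : 2 ^+ 2 = 4) ?ler_wpM2l//; ring.
Qed.

End Net.

(** * The mean of a continuous function over the sphere *)

Section Continuity.
Context {R : realType} {T : topologicalType}.
Implicit Types f g : T -> R.

Lemma continuous_cst (c : R) : continuous (fun _ : T => c).
Proof. by move=> v; exact: cvg_cst. Qed.

Lemma continuous_mul f g : continuous f -> continuous g -> continuous (fun v => f v * g v).
Proof. by move=> cf cg v; apply: (@continuousM R T f g v); [exact: cf|exact: cg]. Qed.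

Lemma continuous_add f g : continuous f -> continuous g -> continuous (fun v => f v + g v).
Proof. by move=> cf cg v; apply: (@cvgD R R^o T); [exact: cf|exact: cg]. Qed.

Lemma continuous_fun_comp (h : R -> R) f :
  continuous h -> continuous f -> continuous (fun v => h (f v)).
Proof. by move=> ch cf v; apply: (@continuous_comp T R R f h v); [exact: cf|exact: ch]. Qed.

Lemma continuous_bigsum (I : Type) (s : seq I) (P : pred I) (F : I -> T -> R) :
  (forall i, continuous (F i)) -> continuous (fun v => \sum_(i <- s | P i) F i v).
Proof.
move=> cF; elim: s => [|i s IH].
  by under eq_fun do rewrite big_nil; exact: continuous_cst.
under eq_fun do rewrite big_cons.
by case: (P i) => //; exact: continuous_add.
Qed.

Lemma continuous_rV (n : nat) (f : T -> 'rV[R]_n) :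
  (forall i, continuous (fun v => f v 0 i)) -> continuous f.
Proof.
move=> cf v; apply/cvg_ballP => e e0.
have h : \forall y \near v, forall i, ball (f v 0 i) e (f y 0 i).
  apply: filter_forall => i; have /cvg_ballP := cf i v; exact.
near=> y; split=> // i j; rewrite (ord1 i); move: j.
by near: y.
Unshelve. all: by end_near. Qed.

Lemma continuous_sub f g : continuous f -> continuous g -> continuous (fun v => f v - g v).
Proof. by move=> cf cg v; apply: (@cvgB R R^o T); [exact: cf|exact: cg]. Qed.

Lemma continuous_max0 f : continuous f -> continuous (fun v => Num.max 0 (f v)).
Proof.
by move=> cf v; apply: (@continuous_max R T (fun=> 0) f); [exact: cvg_cst|exact: cf].
Qed.

End Continuity.

Section Borel.
Context {R : realType} {n : nat}.

Lemma continuous_measurable_rV (f : 'rV[R]_n -> R) :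
  continuous f -> measurable_fun [set: borelRV R n] (f : borelRV R n -> R).
Proof.
move=> /continuousP cf; apply: (measurability _ (RGenOpens.measurableE R)).
move=> _ [_ [a [b ->] <-]]; rewrite setTI; apply: sub_sigma_algebra.
exact/cf/interval_open.
Qed.

Lemma continuous_rV_measurable (f : 'rV[R]_n -> 'rV[R]_n) :
  continuous f -> measurable_fun [set: borelRV R n] (f : borelRV R n -> borelRV R n).
Proof.
move=> /continuousP cf; apply: measurability => //.
by move=> _ [B oB <-]; rewrite setTI; apply: sub_sigma_algebra; exact: cf.
Qed.

Lemma dotv_continuous (u : 'rV[R]_n) : continuous (fun v => dotv v u).
Proof.
apply: continuous_bigsum => i; apply: continuous_mul; last exact: continuous_cst.
exact: coord_continuous.
Qed.

Lemma dotv_sq_continuous : continuous (fun v : 'rV[R]_n => dotv v v).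
Proof.
by apply: continuous_bigsum => i; apply: continuous_mul; exact: coord_continuous.
Qed.

Lemma unit_sphereE : @unit_sphere R n = [set v | dotv v v = 1].
Proof. by apply/seteqP; split=> v /norm2_eq1. Qed.

Lemma closed_unit_sphere : closed (@unit_sphere R n).
Proof.
rewrite unit_sphereE (_ : [set _ | _] = (fun v => dotv v v) @^-1` [set 1])//.
apply: preimage_closed; last exact: closed_eq.
by move=> v _; exact: dotv_sq_continuous.
Qed.

Lemma measurable_unit_sphere : measurable (@unit_sphere R n : set (borelRV R n)).
Proof.
rewrite -[@unit_sphere R n]setCK; apply: measurableC; apply: sub_sigma_algebra.
by apply: closed_openC; exact: closed_unit_sphere.
Qed.

Lemma compact_unit_sphere : compact (@unit_sphere R n).
Proof.
apply: bounded_closed_compact; last exact: closed_unit_sphere.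
exists 1; split=> // M M1 v; rewrite unit_sphereE /= => v1.
rewrite /Num.norm /= mx_normrE; apply/bigmax_leP; split=> [|[i j] _ /=].
  by rewrite (le_trans _ (ltW M1)).
rewrite (ord1 i) (le_trans _ (ltW M1))// -(@expr_le1 _ 2)// real_normK ?num_real//.
rewrite -v1 /dotv (bigD1 j)//= -expr2 lerDl sumr_ge0// => k _.
by rewrite -expr2 sqr_ge0.
Qed.

Lemma continuous_bounded_sphere (f : 'rV[R]_n -> R) : continuous f ->
  [bounded f x | x in (@unit_sphere R n)].
Proof.
move=> cf; have : compact (f @` @unit_sphere R n).
  apply: continuous_compact; last exact: compact_unit_sphere.
  exact: continuous_subspaceT.
move/compact_bounded => [M [Mr hM]]; exists M; split=> // x Mx y Sy.
by apply: hM => //; exists y.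
Qed.

End Borel.

Section Mean.
Context {R : realType} {n : nat} (mu : probability (borelRV R n) R).
Hypothesis muU : uniform_on_sphere mu.
Implicit Types f g : 'rV[R]_n -> R.

(** Integrating over the sphere, which is compact and has full measure, makes every
    continuous function integrable. *)
Definition mean f : R := \int[mu]_(v in (@unit_sphere R n : set (borelRV R n))) f v.

Lemma integrable_sphere f : continuous f ->
  mu.-integrable (@unit_sphere R n : set (borelRV R n)) (EFin \o f).
Proof.
move=> cf; apply: measurable_bounded_integrable.
- exact: measurable_unit_sphere.
- by rewrite [X in (X < _)%E](proj1 muU) ltry.
- by apply: measurable_funTS; exact: continuous_measurable_rV.
- exact: continuous_bounded_sphere.
Qed.

Lemma mean_cst c : mean (fun=> c) = c.
Proof.
rewrite /mean Rintegral_cst; last exact: measurable_unit_sphere.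
by rewrite [X in _ * fine X](proj1 muU) /= mulr1.
Qed.

Lemma meanD f g : continuous f -> continuous g ->
  mean (fun v => f v + g v) = mean f + mean g.
Proof.
move=> cf cg; apply: RintegralD; [exact: measurable_unit_sphere|..];
  exact: integrable_sphere.
Qed.

Lemma meanZ c f : continuous f -> mean (fun v => c * f v) = c * mean f.
Proof.
move=> cf; apply: RintegralZl; [exact: measurable_unit_sphere|].
exact: integrable_sphere.
Qed.

Lemma mean_sum (I : Type) (s : seq I) (P : pred I) (f : I -> 'rV[R]_n -> R) :
  (forall i, continuous (f i)) ->
  mean (fun v => \sum_(i <- s | P i) f i v) = \sum_(i <- s | P i) mean (f i).
Proof.
move=> cf; elim: s => [|i s IH].
  rewrite big_nil -[RHS](mean_cst 0); congr mean.
  by apply/funext => v; rewrite big_nil.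
rewrite big_cons -IH; case: ifPn => Pi; last first.
  by congr mean; apply/funext => v; rewrite big_cons (negPf Pi).
rewrite -meanD//; last exact: continuous_bigsum.
by congr mean; apply/funext => v; rewrite big_cons Pi.
Qed.

Lemma eq_mean f g : (forall v, dotv v v = 1 -> f v = g v) -> mean f = mean g.
Proof.
move=> fg; apply: eq_Rintegral => v /set_mem; rewrite unit_sphereE; exact: fg.
Qed.

Lemma le_mean f g : continuous f -> continuous g ->
  (forall v, dotv v v = 1 -> f v <= g v) -> mean f <= mean g.
Proof.
move=> cf cg fg; apply: le_Rintegral; [exact: measurable_unit_sphere|..].
- exact: integrable_sphere.
- exact: integrable_sphere.
- by move=> v; rewrite unit_sphereE; exact: fg.
Qed.

Lemma mean_orthogonal f (Q : 'M[R]_n) : continuous f -> Q *m Q^T = 1%:M ->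
  mean (fun v => f (v *m Q)) = mean f.
Proof.
move=> cf QQ; have [_ hQ] := muU.
have dQ v w : dotv (v *m Q) (w *m Q) = dotv v w.
  have dE (x y : 'rV[R]_n) : dotv x y = (x *m y^T) 0 0.
    by rewrite mxE; apply: eq_bigr => i _; rewrite mxE.
  by rewrite !dE trmx_mul -mulmxA (mulmxA Q) QQ mul1mx.
have cphi : continuous (fun v : 'rV[R]_n => v *m Q).
  apply: continuous_rV => i.
  rewrite (_ : (fun v => _) = (fun v => dotv v (row i Q^T))); first exact: dotv_continuous.
  by apply/funext => v; rewrite mxE; apply: eq_bigr => j _; rewrite !mxE.
have mphi := continuous_rV_measurable cphi.
pose phi : borelRV R n -> borelRV R n := fun v => v *m Q.
pose phiM : {mfun borelRV R n >-> borelRV R n} :=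
  HB.pack phi (isMeasurableFun.Build _ _ _ _ _ mphi).
have SQ : phi @^-1` (@unit_sphere R n) = @unit_sphere R n.
  by rewrite unit_sphereE; apply/seteqP; split=> v /=; rewrite dQ.
have cfQ : continuous (fun v : 'rV[R]_n => f (v *m Q)).
  move=> v; have := @continuous_comp 'rV[R]_n 'rV[R]_n R (fun v => v *m Q) f v.
  by apply; [exact: cphi|exact: cf].
rewrite /mean /Rintegral; congr fine.
rewrite -[in LHS]SQ -[LHS](@integral_pushforward _ _ _ _ R phiM (measurable_funPT phiM)
  mu (@unit_sphere R n) (EFin \o f)).
- apply: eq_measure_integral => A mA _; exact: hQ.
- by apply/measurable_EFinP; exact: continuous_measurable_rV.
- by rewrite SQ; exact: (integrable_sphere cfQ).
- exact: measurable_unit_sphere.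
Qed.

End Mean.

(** * One-dimensional marginals of the uniform distribution *)

Section Orthogonal.
Context {R : realType} {n : nat}.
Implicit Types u v w : 'rV[R]_n.

Lemma dotv_mul u v : (u *m v^T) 0 0 = dotv u v.
Proof. by rewrite mxE; apply: eq_bigr => i _; rewrite mxE. Qed.

Lemma dotv_orthogonal (Q : 'M[R]_n) v w : Q *m Q^T = 1%:M ->
  dotv (v *m Q) (w *m Q) = dotv v w.
Proof. by move=> QQ; rewrite -!dotv_mul trmx_mul -mulmxA (mulmxA Q) QQ mul1mx. Qed.

Lemma dotv_delta v i : dotv v (delta_mx 0 i) = v 0 i.
Proof.
rewrite /dotv (bigD1 i)//= mxE !eqxx mulr1 big1 ?addr0// => j ji.
by rewrite mxE (negPf ji) andbF mulr0.
Qed.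

(** The reflection exchanging [u] and [v]. *)
Lemma exists_orthogonal u v : dotv u u = 1 -> dotv v v = 1 ->
  exists2 Q : 'M[R]_n, Q *m Q^T = 1%:M & v *m Q = u.
Proof.
move=> u1 v1; have [<-|uv] := eqVneq u v.
  by exists 1%:M; rewrite ?tr_scalar_mx mulmx1.
pose w := v - u; have w0 : dotv w w != 0 by rewrite dotv_eq0 subr_eq0 eq_sym.
have ww : dotv w w = 2 * dotv v w.
  by rewrite /w !(dotvBl, dotvBr) u1 v1 (dotvC u v); ring.
have uE : u = v - w by rewrite /w opprB addrC subrK.
clearbody w; pose c := 2 / dotv w w; pose H : 'M[R]_n := 1%:M - c *: (w^T *m w).
have vH x : x *m H = x - (c * dotv x w) *: w.
  rewrite /H mulmxBr mulmx1 -scalemxAr mulmxA (mx11_scalar (x *m w^T)) dotv_mul.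
  by rewrite mul_scalar_mx scalerA.
have HT : H^T = H.
  apply/matrixP => i j; rewrite !mxE eq_sym; congr (_ - c * _).
  by apply: eq_bigr => k _; rewrite !mxE mulrC.
exists H; last first.
  rewrite vH uE (_ : c * dotv v w = 1) ?scale1r// /c ww.
  by field; move: w0; rewrite ww mulf_eq0 negb_or => /andP[].
rewrite HT; apply/row_matrixP => i; rewrite row_mul vH.
have -> : row i H = row i 1%:M - (c * dotv (row i 1%:M) w) *: w by rewrite -vH -row_mul mul1mx.
rewrite dotvBl dotvZl -addrA -opprD -scalerDl.
rewrite (_ : c * _ + c * _ = 0) ?scale0r ?subr0// /c; by field.
Qed.

End Orthogonal.

Section Marginals.
Context {R : realType} {n : nat} (mu : probability (borelRV R n) R).
Hypothesis muU : uniform_on_sphere mu.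
Implicit Types (u v : 'rV[R]_n) (g : R -> R).

Lemma continuous_marginal g u : continuous g -> continuous (fun v => g (dotv v u)).
Proof. by move=> cg; apply: continuous_fun_comp => //; exact: dotv_continuous. Qed.

(** Invariance under the reflection exchanging [u] and [v]. *)
Lemma mean_marginal g u v : continuous g -> dotv u u = 1 -> dotv v v = 1 ->
  mean mu (fun x => g (dotv x u)) = mean mu (fun x => g (dotv x v)).
Proof.
move=> cg u1 v1; have [Q QQ vQ] := exists_orthogonal u1 v1.
rewrite -(mean_orthogonal muU (continuous_marginal (u := u) cg) QQ).
by congr mean; apply/funext => x; rewrite -vQ dotv_orthogonal.
Qed.

Lemma dotv_delta_unit (i : 'I_n) : dotv (delta_mx 0 i) (delta_mx 0 i : 'rV[R]_n) = 1.
Proof. by rewrite dotv_delta mxE !eqxx. Qed.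

Lemma mean_marginal_coord g u i : continuous g -> dotv u u = 1 ->
  mean mu (fun x => g (dotv x u)) = mean mu (fun x => g (x 0 i)).
Proof.
move=> cg u1; rewrite (mean_marginal cg u1 (dotv_delta_unit i)).
by congr mean; apply/funext => x; rewrite dotv_delta.
Qed.

Let cexp k : continuous (fun x : R => x ^+ k).
Proof. exact: exprn_continuous. Qed.

Lemma continuous_coord_exp i k : continuous (fun v : 'rV[R]_n => v 0 i ^+ k).
Proof. by apply: (continuous_fun_comp (cexp (k := k))); exact: coord_continuous. Qed.

Lemma continuous_coord_exp2 i j k l :
  continuous (fun v : 'rV[R]_n => v 0 i ^+ k * v 0 j ^+ l).
Proof. by apply: continuous_mul; exact: continuous_coord_exp. Qed.

(** Sum over the coordinates: their squares add up to [1] on the sphere. *)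
Lemma mean_marginal_sqr u : dotv u u = 1 ->
  n%:R * mean mu (fun x => dotv x u ^+ 2) = 1.
Proof.
move=> u1; rewrite -[RHS](mean_cst muU).
rewrite (@eq_mean _ _ _ (fun=> 1) (fun x => \sum_i x 0 i ^+ 2)); last first.
  by move=> v <-; apply: eq_bigr => i _; rewrite expr2.
rewrite (mean_sum muU); last by move=> i; exact: continuous_coord_exp.
rewrite (eq_bigr (fun=> mean mu (fun x => dotv x u ^+ 2))).
  by rewrite sumr_const card_ord mulr_natl.
by move=> i _; rewrite (@mean_marginal_coord _ u i (cexp (k := 2))).
Qed.

(** Rotating by 45 degrees in the plane of the axes [i] and [j] expresses the
    mixed moment through the fourth moment of one coordinate. *)
Lemma mean_mixed_moment i j : i != j ->
  3 * mean mu (fun x => x 0 i ^+ 2 * x 0 j ^+ 2) = mean mu (fun x => x 0 i ^+ 4).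
Proof.
move=> ij; have s2 : (Num.sqrt 2 : R) ^+ 2 = 2 by rewrite sqr_sqrtr.
have s0 : (Num.sqrt 2 : R) != 0 by rewrite gt_eqF// sqrtr_gt0.
pose e k : 'rV[R]_n := delta_mx 0 k.
have eij : dotv (e i) (e j) = 0 by rewrite dotv_delta mxE eqxx eq_sym (negPf ij).
have up : dotv ((Num.sqrt 2)^-1 *: (e i + e j)) ((Num.sqrt 2)^-1 *: (e i + e j)) = 1.
  rewrite dotvZl dotvZr !(dotvDl, dotvDr) (dotvC (e j)) eij !dotv_delta_unit.
  by rewrite mulrA -invfM -expr2 s2; field.
have um : dotv ((Num.sqrt 2)^-1 *: (e i - e j)) ((Num.sqrt 2)^-1 *: (e i - e j)) = 1.
  rewrite dotvZl dotvZr !(dotvBl, dotvBr) (dotvC (e j)) eij !dotv_delta_unit.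
  by rewrite mulrA -invfM -expr2 s2; field.
have cc u : continuous (fun v => dotv v u ^+ 4).
  exact: (continuous_marginal (u := u) (cexp (k := 4))).
have hp := mean_marginal_coord i (cexp (k := 4)) up.
have hm := mean_marginal_coord i (cexp (k := 4)) um.
have hj := mean_marginal_coord i (cexp (k := 4)) (dotv_delta_unit j).
have {}hj : mean mu (fun x => x 0 j ^+ 4) = mean mu (fun x => x 0 i ^+ 4).
  by rewrite -hj; congr mean; apply/funext => x; rewrite dotv_delta.
have : mean mu (fun x => dotv x ((Num.sqrt 2)^-1 *: (e i + e j)) ^+ 4
                       + dotv x ((Num.sqrt 2)^-1 *: (e i - e j)) ^+ 4) =
       mean mu (fun x => 1 / 2 * (x 0 i ^+ 4 + x 0 j ^+ 4) + 3 * (x 0 i ^+ 2 * x 0 j ^+ 2)).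
  congr mean; apply/funext => x; rewrite !dotvZr dotvDr dotvBr !dotv_delta !exprMn exprVn.
  rewrite (_ : (Num.sqrt 2 : R) ^+ 4 = 4); first by field.
  by rewrite (exprM _ 2 2) s2; ring.
rewrite (meanD muU)// (meanD muU)/=; last 2 first.
- apply: continuous_mul; first exact: continuous_cst.
  by apply: continuous_add; exact: continuous_coord_exp.
- by apply: continuous_mul; [exact: continuous_cst|exact: continuous_coord_exp2].
rewrite (meanZ muU) ?(meanZ muU); last 2 first.
- by apply: continuous_add; exact: continuous_coord_exp.
- exact: continuous_coord_exp2.
rewrite (meanD muU) ?hp ?hm ?hj; last 2 first.
- exact: continuous_coord_exp.
- exact: continuous_coord_exp.
lra.
Qed.

Let mean_block (q : R) (A : {set 'I_n}) :
  (forall i, mean mu (fun x => x 0 i ^+ 4) = q) ->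
  3 * mean mu (fun x => (\sum_(i in A) x 0 i ^+ 2) ^+ 2) = #|A|%:R * (#|A|%:R + 2) * q.
Proof.
move=> hq.
have -> : (fun x : 'rV[R]_n => (\sum_(i in A) x 0 i ^+ 2) ^+ 2) =
  (fun x => \sum_(i in A) \sum_(j in A) x 0 i ^+ 2 * x 0 j ^+ 2).
  apply/funext => x; rewrite expr2 mulr_suml; apply: eq_bigr => i _.
  by rewrite mulr_sumr.
rewrite (mean_sum muU); last first.
  by move=> i; apply: continuous_bigsum => j; exact: continuous_coord_exp2.
rewrite mulr_sumr (eq_bigr (fun=> (#|A|%:R + 2) * q)) => [|i iA].
  by rewrite sumr_const -[LHS]mulr_natl mulrA.
rewrite (mean_sum muU); last by move=> j; exact: continuous_coord_exp2.
rewrite (bigD1 i)//= mulrDr mulr_sumr.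
rewrite (eq_bigr (fun=> q)) => [|j /andP[jA ji]]; last first.
  by rewrite mean_mixed_moment ?hq// eq_sym.
have -> : mean mu (fun x => x 0 i ^+ 2 * x 0 i ^+ 2) = q.
  by rewrite -(hq i); congr mean; apply/funext => x; rewrite -exprD.
rewrite sumr_const (_ : #|_| = #|A :\ i|); last first.
  by apply: eq_card => j; rewrite !inE andbC.
have -> : (#|A|%:R : R) = 1 + #|A :\ i|%:R by rewrite (cardsD1 i A) iA natrD.
rewrite -[q *+ _]mulr_natl; ring.
Qed.

(** The sum of all squared coordinates is [1] on the sphere, so its second moment,
    expressed through the fourth moment of one coordinate, determines the latter. *)
Lemma mean_coord4 i : n%:R * (n%:R + 2) * mean mu (fun x => x 0 i ^+ 4) = 3.
Proof.
have := @mean_block (mean mu (fun x => x 0 i ^+ 4)) [set: 'I_n].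
rewrite cardsT card_ord => <-.
  rewrite -[RHS]mulr1; congr (_ * _); rewrite -[RHS](mean_cst muU).
  apply: eq_mean => v v1; rewrite (eq_bigl xpredT); last by move=> j; rewrite inE.
  rewrite (_ : \sum_j v 0 j ^+ 2 = 1) ?expr1n// -v1.
move=> j; rewrite -(mean_marginal_coord i (cexp (k := 4)) (dotv_delta_unit j)).
by congr mean; apply/funext => x; rewrite dotv_delta.
Qed.

Lemma mean_marginal4 u : dotv u u = 1 ->
  n%:R * (n%:R + 2) * mean mu (fun x => dotv x u ^+ 4) = 3.
Proof.
move=> u1; have [i _|n0] := pickP (@predT 'I_n).
  by rewrite (mean_marginal_coord i (cexp (k := 4)) u1) mean_coord4.
move: u1; rewrite /dotv big1 => [/eqP|i]; first by rewrite eq_sym oner_eq0.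
by have := n0 i.
Qed.

Lemma mean_block_sqr (A : {set 'I_n}) : (0 < n)%N ->
  mean mu (fun x => (\sum_(i in A) x 0 i ^+ 2) ^+ 2) =
  #|A|%:R * (#|A|%:R + 2) / (n%:R * (n%:R + 2)).
Proof.
move=> n0; pose i0 := Ordinal n0.
have hq i : mean mu (fun x => x 0 i ^+ 4) = mean mu (fun x => x 0 i0 ^+ 4).
  rewrite -(mean_marginal_coord i0 (cexp (k := 4)) (dotv_delta_unit i)).
  by congr mean; apply/funext => x; rewrite dotv_delta.
have := mean_block A hq; have := mean_coord4 i0.
set q := mean mu _; set b := mean mu _ => h4 hb.
have np : 0 < (n%:R : R) by rewrite ltr0n.
have nn : n%:R * (n%:R + 2) != 0 :> R by rewrite gt_eqF// mulr_gt0// addr_gt0.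
apply: (mulIf nn); rewrite divfK//.
have : 3 * (b * (n%:R * (n%:R + 2))) = 3 * (#|A|%:R * (#|A|%:R + 2)).
  by rewrite mulrA hb -[in RHS]h4; ring.
lra.
Qed.

End Marginals.

(** * Exponential moments of the marginals *)

Section ExpBounds.
Context {R : realType}.
Implicit Types x y : R.

Lemma expR_le_quadratic x : expR x <= 1 + x + x ^+ 2 * expR `|x|.
Proof.
have [x0|x0] := leP 0 x.
  (* [expR x * (1 - x) <= 1], multiplied by [1 + x] *)
  rewrite ger0_norm//; have h : expR x * (1 - x) <= 1.
    have := expR_ge1Dx (- x); rewrite -(ler_pM2l (expR_gt0 x)) -expRD subrr expR0; lra.
  have := expR_gt0 x; nra.
have e1 : 1 <= expR `|x| by rewrite -expR0 ler_expR.
have h : expR x <= 1 + x + x ^+ 2.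
  have [x1|x1] := leP x (-1).
    by apply: (@le_trans _ _ 1); [rewrite expR_le1 ltW|nra].
  have : expR x * (1 - x) <= 1.
    have := expR_ge1Dx (- x); rewrite -(ler_pM2l (expR_gt0 x)) -expRD subrr expR0; lra.
  have : expR x <= 1 by rewrite expR_le1 ltW.
  by have := expR_gt0 x; nra.
by apply: (le_trans h); rewrite lerD2l ler_peMr// sqr_ge0.
Qed.

Lemma expR1_le3 : expR 1 <= 3 :> R.
Proof.
have h : expR (- (1 / 6)) >= 5 / 6 :> R by have := expR_ge1Dx (- (1 / 6) : R); lra.
have h6 : (5 / 6) ^+ 6 <= expR (- 1) :> R.
  rewrite (_ : - 1 = 6 * (- (1 / 6)) :> R); last by field.
  by rewrite expRM_natl lerXn2r ?nnegrE ?expR_ge0.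
have e : expR 1 * expR (- 1) = 1 :> R by rewrite -expRD subrr expR0.
have e0 := @expR_gt0 R 1.
have : expR 1 * (5 / 6) ^+ 6 <= 1 :> R by have := ler_wpM2l (ltW e0) h6; rewrite e.
have : 1 / 3 <= (5 / 6) ^+ 6 :> R by rewrite !exprS expr0; lra.
have := expR_gt0 (1 : R); nra.
Qed.

(** By [expR_le_quadratic] if [`|x| <= 1]; beyond, [`|x| <= 3 * x ^+ 2]. The sharp
    constant is [1 / 2], but only its being absolute matters. *)
Lemma cosh_le_expR x : expR x + expR (- x) <= 2 * expR (3 * x ^+ 2).
Proof.
have [x1|x1] := leP `|x| 1.
  have := expR_le_quadratic x; have := expR_le_quadratic (- x).
  rewrite normrN sqrrN.
  have : expR `|x| <= 3 by apply: le_trans expR1_le3; rewrite ler_expR.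
  have := expR_ge1Dx (3 * x ^+ 2); have := sqr_ge0 x; nra.
have hx : `|x| <= 3 * x ^+ 2.
  by rewrite -(real_normK (num_real x)); nra.
rewrite mulr_natl mulr2n lerD// ler_expR (le_trans _ hx)//; first exact: ler_norm.
by rewrite -normrN ler_norm.
Qed.

Lemma sqr_le_expR x : 0 <= x -> x ^+ 2 <= 4 * expR x.
Proof.
move=> x0; have h : 1 + x / 2 <= expR (x / 2) by exact: expR_ge1Dx.
have -> : expR x = expR (x / 2) ^+ 2 by rewrite expr2 -expRD -splitr.
have := expR_gt0 (x / 2); nra.
Qed.

End ExpBounds.

Section Subgaussian.
Context {R : realType} {n : nat} (mu : probability (borelRV R n) R).
Hypothesis muU : uniform_on_sphere mu.
Hypothesis n_gt0 : (0 < n)%N.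
Implicit Types (u v : 'rV[R]_n) (f : R -> R).

Let N := Num.sqrt (n%:R : R).

Let N_gt0 : 0 < N. Proof. by rewrite sqrtr_gt0 ltr0n. Qed.

Let N2 : N ^+ 2 = n%:R. Proof. by rewrite sqr_sqrtr. Qed.

Lemma continuous_scaled_marginal f u : continuous f -> continuous (fun x => f (N * dotv x u)).
Proof.
move=> cf; apply: continuous_fun_comp => //; apply: continuous_mul; first exact: continuous_cst.
exact: dotv_continuous.
Qed.

Let cexpR (c : R) : continuous (fun y : R => expR (c * y)).
Proof.
apply: continuous_fun_comp; first exact: continuous_expR.
by apply: continuous_mul; [exact: continuous_cst|move=> y; exact: cvg_id].
Qed.

(** All directions have the same marginal, so the direction may be averaged over
    the [2 ^ n] normalised sign vectors. For a fixed unit vector [x] this average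
    is a product of hyperbolic cosines of the coordinates of [x], each bounded by
    [cosh_le_expR], and the exponents add up to [3 * theta ^+ 2]. *)
Lemma mean_expR_marginal (theta : R) u : dotv u u = 1 ->
  mean mu (fun x => expR (theta * (N * dotv x u))) <= expR (3 * theta ^+ 2).
Proof.
move=> u1; pose e (s : {ffun 'I_n -> bool}) : 'rV[R]_n := \row_i ((-1) ^+ s i / N).
have e1 s : dotv (e s) (e s) = 1.
  rewrite /dotv (eq_bigr (fun=> (n%:R)^-1)) => [|i _].
    by rewrite sumr_const card_ord -[LHS]mulr_natl mulfV// gt_eqF// ltr0n.
  by rewrite mxE mulrACA -invfM -!expr2 N2 sqrr_sign mul1r.
have c1 v : continuous (fun x => expR (theta * (N * dotv x v))).
  exact: (continuous_scaled_marginal (f := fun y => expR (theta * y))).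
have eqm (s : {ffun 'I_n -> bool}) : mean mu (fun x => expR (theta * (N * dotv x u))) =
             mean mu (fun x => \prod_i expR ((-1) ^+ s i * (theta * x 0 i))).
  rewrite (mean_marginal muU (g := fun y => expR (theta * (N * y))) _ u1 (e1 s)); last first.
    apply: (continuous_fun_comp (h := fun y => expR (theta * y)) (f := fun y => N * y)) => //.
    by apply: continuous_mul; [exact: continuous_cst|move=> y; exact: cvg_id].
  congr mean; apply/funext => x; rewrite -(big_morph expR (@expRD R) (@expR0 R)).
  congr expR; rewrite /dotv !mulr_sumr; apply: eq_bigr => i _; rewrite mxE.
  by field; rewrite gt_eqF.
have p2 : 0 < (2 ^+ n : R) by rewrite exprn_gt0.
rewrite -(ler_pM2l p2).
have -> : 2 ^+ n * mean mu (fun x => expR (theta * (N * dotv x u))) =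
   mean mu (fun x => \prod_(i < n) (expR (theta * x 0 i) + expR (- (theta * x 0 i)))).
  transitivity (\sum_(s : {ffun 'I_n -> bool})
      mean mu (fun x => \prod_i expR ((-1) ^+ s i * (theta * x 0 i)))).
    rewrite (eq_bigr (fun=> mean mu (fun x => expR (theta * (N * dotv x u))))); last first.
      by move=> s _; rewrite (eqm s).
    by rewrite sumr_const card_ffun card_bool card_ord -[RHS]mulr_natl natrX.
  rewrite -(mean_sum muU); last first.
    move=> s.
    have -> : (fun x : 'rV[R]_n => \prod_i expR ((-1) ^+ s i * (theta * x 0 i))) =
        (fun x => expR (\sum_i (-1) ^+ s i * (theta * x 0 i))).
      by apply/funext => x; rewrite (big_morph expR (@expRD R) (@expR0 R)).
    apply: continuous_fun_comp; first exact: continuous_expR.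
    apply: continuous_bigsum => i; apply: continuous_mul; first exact: continuous_cst.
    by apply: continuous_mul; [exact: continuous_cst|exact: coord_continuous].
  congr mean; apply/funext => x.
  rewrite -(bigA_distr_bigA (fun i (b : bool) => expR ((-1) ^+ b * (theta * x 0 i)))) /=.
  by apply: eq_bigr => i _; rewrite big_bool /= expr1 expr0 mulN1r mul1r addrC.
rewrite -[leRHS](mean_cst muU); apply: (le_mean muU).
- have cc (t : R) i : continuous (fun x : 'rV[R]_n => expR (t * x 0 i)).
    apply: continuous_fun_comp; first exact: continuous_expR.
    by apply: continuous_mul; [exact: continuous_cst|exact: coord_continuous].
  have : forall s : seq 'I_n, continuous (fun x : 'rV[R]_n =>
      \prod_(i <- s) (expR (theta * x 0 i) + expR (- (theta * x 0 i)))).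
    elim=> [|i s IH].
      by under eq_fun do rewrite big_nil; exact: continuous_cst.
    under eq_fun do rewrite big_cons; apply: continuous_mul => //.
    apply: continuous_add; first exact: cc.
    by under eq_fun do rewrite -mulNr; exact: cc.
  by move=> cp; exact: cp.
- exact: continuous_cst.
move=> x x1; apply: (@le_trans _ _ (\prod_(i < n) (2 * expR (3 * (theta * x 0 i) ^+ 2)))).
  apply: ler_prod => i _; rewrite cosh_le_expR andbT.
  by rewrite addr_ge0// expR_ge0.
rewrite big_split /= prodr_const card_ord -(big_morph expR (@expRD R) (@expR0 R)).
rewrite -mulr_sumr (_ : \sum_i _ = theta ^+ 2)// -[RHS]mulr1 -x1 mulr_sumr.
by apply: eq_bigr => i _; rewrite exprMn -expr2.
Qed.

(** The Gaussian sum in the proof of [mean_expR_sqr] is dominated by a geometric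
    series of ratio [expR (- (1 / 64))]. *)
Definition expsq_const : R := 2 * expR (1 / 8) / (1 - expR (- (1 / 64))).

Lemma expsq_const_gt0 : 0 < expsq_const.
Proof.
rewrite divr_gt0 ?mulr_gt0 ?expR_gt0// subr_gt0 -[ltRHS]expR0 ltr_expR; lra.
Qed.

(** [expR (y ^+ 2 / 32)] is dominated by a Gaussian mixture of the exponentials
    [expR (theta * y)], sampled at the points [theta = j / 8]: the term [j] next
    above [`|y|] suffices. The sum is finite since [`|y| <= n] on the sphere. *)
Lemma mean_expR_sqr u : dotv u u = 1 ->
  mean mu (fun x => expR ((N * dotv x u) ^+ 2 / 32)) <= expsq_const.
Proof.
move=> u1; pose th (j : nat) : R := j%:R / 8.
pose w (j : nat) : R := expR (1 / 8) * expR (- (4 * th j ^+ 2)).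
have w0 j : 0 <= w j by rewrite mulr_ge0 ?expR_ge0.
pose h j (x : 'rV[R]_n) := w j * (expR (th j * (N * dotv x u)) + expR (- th j * (N * dotv x u))).
have c1 (t : R) : continuous (fun x => expR (t * (N * dotv x u))).
  exact: (continuous_scaled_marginal (f := fun y => expR (t * y))).
have ch j : continuous (h j).
  by apply: continuous_mul; [exact: continuous_cst|apply: continuous_add; exact: c1].
apply: (@le_trans _ _ (mean mu (fun x => \sum_(j < n.+2) h j x))).
  apply: (le_mean muU) => //.
  - apply: (continuous_scaled_marginal (f := fun y => expR (y ^+ 2 / 32))).
    apply: continuous_fun_comp; first exact: continuous_expR.
    by apply: continuous_mul; [exact: exprn_continuous|exact: continuous_cst].
  - exact: continuous_bigsum.
  move=> x x1; set y := N * dotv x u.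
  have yn : `|y| <= n%:R.
    rewrite -ler_sqr ?nnegrE// real_normK ?num_real// /y exprMn N2 expr2.
    rewrite ler_wpM2l// (le_trans (sqr_dotv_le _ x1))// u1.
    by rewrite ler1n.
  pose j := (Num.truncn `|y|).+1.
  have jn : (j < n.+2)%N by rewrite /j !ltnS truncn_le_nat// (le_lt_trans yn)// ltr_nat.
  have jy : `|y| <= j%:R by rewrite ltW// truncnS_gt.
  have yj : j%:R - 1 <= `|y| by rewrite /j -natr1 addrK truncn_le.
  have h0 i : 0 <= h i x by rewrite mulr_ge0// addr_ge0 ?expR_ge0.
  rewrite (bigD1 (Ordinal jn))//= -[leLHS]addr0 lerD ?sumr_ge0//.
  rewrite /h -/y /w -mulrA.
  have step : expR (y ^+ 2 / 32) <= expR (1 / 8) * (expR (- (4 * th j ^+ 2)) * expR (th j * `|y|)).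
    rewrite -!expRD ler_expR /th -(real_normK (num_real y)).
    have y0 := normr_ge0 y; have j1 : 1 <= (j%:R : R) by rewrite ler1n.
    have hh := sqr_ge0 (j%:R - 2 : R).
    by nra.
  apply: (le_trans step); rewrite ler_wpM2l ?expR_ge0// ler_wpM2l ?expR_ge0//.
  have [y0|y0] := leP 0 y.
    by rewrite ger0_norm// lerDl expR_ge0.
  by rewrite ltr0_norm// mulrN -mulNr lerDr expR_ge0.
rewrite (mean_sum muU)//.
apply: (@le_trans _ _ (\sum_(j < n.+2) 2 * expR (1 / 8) * expR (- (1 / 64)) ^+ j)).
  apply: ler_sum => j _; rewrite /h (meanZ muU); last by apply: continuous_add; exact: c1.
  rewrite (meanD muU)//.
  have := mean_expR_marginal (th j) u1; have := mean_expR_marginal (- th j) u1; rewrite sqrrN.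
  set m1 := mean mu _; set m2 := mean mu _ => h1 h2.
  apply: (@le_trans _ _ (w j * (2 * expR (3 * th j ^+ 2)))).
    by rewrite ler_wpM2l//; lra.
  rewrite /w mulrACA (mulrC _ 2) ler_wpM2l ?mulr_ge0 ?expR_ge0//.
  rewrite -expRM_natl -expRD ler_expR /th.
  have j0 : 0 <= (j%:R : R) by [].
  have jj : (j%:R : R) <= j%:R ^+ 2 by rewrite -natrX ler_nat; case: (j : nat) => // k; rewrite leq_pmull.
  by rewrite expr_div_n; lra.
rewrite -mulr_sumr /expsq_const ler_wpM2l ?mulr_ge0 ?expR_ge0//.
set q := expR _; have q1 : q < 1 by rewrite /q -[ltRHS]expR0 ltr_expR; lra.
have q0 : 0 <= q by exact: expR_ge0.
rewrite -[leRHS]mul1r ler_pdivlMr ?subr_gt0// mulrC.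
have -> : forall k, (1 - q) * \sum_(j < k) q ^+ j = 1 - q ^+ k.
  elim=> [|k IH]; first by rewrite big_ord0 mulr0 expr0 subrr.
  by rewrite big_ord_recr /= mulrDr IH exprS; ring.
by rewrite gerBl exprn_ge0.
Qed.

End Subgaussian.

Lemma continuous_gain (R : realType) (t : R) : continuous (gain t).
Proof.
have csq : continuous (fun y : R => y ^+ 2) by exact: exprn_continuous.
apply: continuous_sub => //; apply: continuous_mul; first exact: continuous_cst.
by apply: continuous_max0; apply: continuous_sub => //; exact: continuous_cst.
Qed.

Lemma continuous_tent (R : realType) (s : R) : continuous (tent s).
Proof.
apply: continuous_max0; apply: continuous_sub; first exact: continuous_cst.
by apply: continuous_mul; [exact: norm_continuous|exact: continuous_cst].
Qed.

Lemma tent_le2 (R : realType) (s y : R) : 0 < s -> tent s y <= 2.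
Proof. by move=> s0; rewrite /tent ge_max ler0n/= gerBl divr_ge0// ltW. Qed.

Lemma tent_eq0 (R : realType) (s y : R) : 0 < s -> 2 * s <= `|y| -> tent s y = 0.
Proof.
move=> s0 sy; apply/max_idPl; rewrite subr_le0 ler_pdivlMr//.
Qed.

Section Growth.
Context {R : realType} {n : nat} (mu : probability (borelRV R n) R).
Hypothesis muU : uniform_on_sphere mu.
Hypothesis n_gt0 : (0 < n)%N.
Implicit Types (u v : 'rV[R]_n) (f : R -> R).

Let N := Num.sqrt (n%:R : R).

Definition growth_const (D : R) : R := 4 * (64 * D) ^+ 2 * expR (1 / 32) * expsq_const.

Lemma growth_const_gt0 (D : R) : 0 < D -> 0 < growth_const D.
Proof.
by move=> D0; rewrite !mulr_gt0 ?exprn_gt0 ?expR_gt0 ?expsq_const_gt0.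
Qed.

(** By [expR_le_quadratic] the exponential exceeds its first order expansion by at
    most [lam ^+ 2] times a function of quadratic exponential growth, whose mean is
    bounded by [mean_expR_sqr]. *)
Lemma mean_expR_growth (D m lam : R) f u : 0 < D -> continuous f ->
  (forall y, `|f y| <= D * (1 + y ^+ 2)) -> 0 <= lam <= (64 * D)^-1 ->
  dotv u u = 1 -> m <= mean mu (fun x => f (N * dotv x u)) ->
  mean mu (fun x => expR (- (lam * f (N * dotv x u)))) <=
    expR (- (lam * m) + lam ^+ 2 * growth_const D).
Proof.
move=> D0 cf fD /andP[l0 lD] u1 hm.
set c := lam ^+ 2 * (4 * (64 * D) ^+ 2 * expR (1 / 32)).
have cN (g : R -> R) : continuous g -> continuous (fun x => g (N * dotv x u)).
  by move=> cg; exact: (continuous_scaled_marginal (f := g)).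
have cs : continuous (fun y : R => expR (y ^+ 2 / 32)).
  apply: continuous_fun_comp; first exact: continuous_expR.
  by apply: continuous_mul; [exact: exprn_continuous|exact: continuous_cst].
have cl : continuous (fun y : R => - lam * f y).
  by apply: continuous_mul => //; exact: continuous_cst.
have pw y : expR (- (lam * f y)) <= 1 + (- lam * f y + c * expR (y ^+ 2 / 32)).
  apply: le_trans (expR_le_quadratic _) _; rewrite mulNr addrA lerD2l.
  rewrite normrN sqrrN normrM (ger0_norm l0).
  have fy := fD y; have f0 := normr_ge0 (f y).
  have y1 : 0 <= (1 + y ^+ 2) / 64 by rewrite divr_ge0// addr_ge0// sqr_ge0.
  have h1 : expR (lam * `|f y|) <= expR ((1 + y ^+ 2) / 64).
    rewrite ler_expR (le_trans (ler_wpM2l l0 fy))//.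
    have : lam * (64 * D) <= 1 by rewrite -ler_pdivlMr ?mulr_gt0// div1r.
    by have := sqr_ge0 y; nra.
  have h2 : (lam * f y) ^+ 2 <= lam ^+ 2 * D ^+ 2 * (4 * 64 ^+ 2 * expR ((1 + y ^+ 2) / 64)).
    rewrite exprMn -mulrA ler_wpM2l ?sqr_ge0//.
    have := sqr_le_expR y1; rewrite -(real_normK (num_real (f y))).
    have : `|f y| ^+ 2 <= (D * (1 + y ^+ 2)) ^+ 2 by rewrite lerXn2r ?nnegrE// (le_trans _ fy).
    rewrite exprMn => ha hb; apply: (le_trans ha); rewrite ler_wpM2l ?sqr_ge0//.
    by move: hb; rewrite expr_div_n; lra.
  apply: (le_trans (ler_pM (sqr_ge0 _) (expR_ge0 _) h2 h1)).
  rewrite -[leLHS]mulrA -[X in _ * X]mulrA -expRD /c.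
  rewrite (_ : (1 + y ^+ 2) / 64 + (1 + y ^+ 2) / 64 = 1 / 32 + y ^+ 2 / 32); last by field.
  by rewrite expRD le_eqVlt; apply/orP; left; apply/eqP; ring.
apply: (@le_trans _ _ (mean mu (fun x => 1 + (- lam * f (N * dotv x u) +
    c * expR ((N * dotv x u) ^+ 2 / 32))))).
  apply: (le_mean muU) => //.
  - apply: (cN (fun y => expR (- (lam * f y)))).
    apply: continuous_fun_comp; first exact: continuous_expR.
    by under eq_fun do rewrite -mulNr.
  - apply: continuous_add; first exact: continuous_cst.
    apply: continuous_add; first exact: (cN (fun y => - lam * f y)).
    by apply: continuous_mul; [exact: continuous_cst|exact: (cN (fun y => expR (y ^+ 2 / 32)))].
have c1 := cN _ cf; have c2 := cN _ cl; have c3 := cN _ cs.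
have c4 : continuous (fun x => c * expR ((N * dotv x u) ^+ 2 / 32)).
  by apply: continuous_mul => //; exact: continuous_cst.
rewrite (meanD muU); [|exact: continuous_cst|exact: continuous_add].
rewrite (mean_cst muU) (meanD muU)// (meanZ muU)// (meanZ muU)//.
apply: le_trans (expR_ge1Dx _); rewrite lerD2l lerD//.
  by rewrite mulNr lerN2 ler_wpM2l.
rewrite /growth_const /c -mulrA ler_wpM2l ?sqr_ge0// ler_wpM2l ?mulr_ge0 ?expR_ge0 ?sqr_ge0 ?(ltW D0)//.
exact: (mean_expR_sqr muU n_gt0 u1).
Qed.

Lemma mean_scaled_sqr u : dotv u u = 1 -> mean mu (fun x => (N * dotv x u) ^+ 2) = 1.
Proof.
move=> u1; rewrite -(mean_marginal_sqr muU u1) -(meanZ muU).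
  by congr mean; apply/funext => x; rewrite exprMn sqr_sqrtr.
by apply: (continuous_marginal (g := fun y => y ^+ 2)); exact: exprn_continuous.
Qed.

Lemma mean_scaled4 u : dotv u u = 1 -> mean mu (fun x => (N * dotv x u) ^+ 4) <= 3.
Proof.
move=> u1; have h := mean_marginal4 muU u1.
have c4 : continuous (fun x => dotv x u ^+ 4).
  by apply: (continuous_marginal (g := fun y => y ^+ 4)); exact: exprn_continuous.
rewrite (_ : mean _ _ = n%:R ^+ 2 * mean mu (fun x => dotv x u ^+ 4)); last first.
  rewrite -(meanZ muU)//; congr mean; apply/funext => x.
  by rewrite exprMn (exprM _ 2 2) sqr_sqrtr.
have : 0 <= mean mu (fun x => dotv x u ^+ 4).
  rewrite -[leLHS](mean_cst muU); apply: (le_mean muU) => //; first exact: continuous_cst.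
  by move=> x _; rewrite (exprM _ 2 2) sqr_ge0.
have : 0 < (n%:R : R) by rewrite ltr0n.
nra.
Qed.

(** The part of [y ^+ 2] beyond the level [t ^+ 2 / 2] is at most
    [y ^+ 4 / (2 * t ^+ 2)], of mean at most [3 / (2 * t ^+ 2)]. *)
Lemma mean_gain u : dotv u u = 1 -> 9 / 10 <= mean mu (fun x => gain 11 (N * dotv x u)).
Proof.
move=> u1; have pw (y : R) : y ^+ 2 + (- (4 / 121)) * y ^+ 4 <= gain 11 y.
  rewrite /gain lerD2l (_ : y ^+ 4 = (y ^+ 2) ^+ 2); last by rewrite -exprM.
  set z := y ^+ 2; have [z0|z0] := leP (z - 11 ^+ 2 / 2) 0; have := sqr_ge0 z; first lra.
  by move=> _; have := sqr_ge0 (z - 121); nra.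
have ce k : continuous (fun x => (N * dotv x u) ^+ k).
  by apply: (continuous_scaled_marginal (f := fun y => y ^+ k)); exact: exprn_continuous.
apply: (@le_trans _ _ (mean mu (fun x => (N * dotv x u) ^+ 2 + (- (4 / 121)) * (N * dotv x u) ^+ 4))).
  rewrite (meanD muU)//; last by apply: continuous_mul => //; exact: continuous_cst.
  by rewrite (meanZ muU)// mean_scaled_sqr//; have := mean_scaled4 u1; lra.
apply: (le_mean muU) => //.
- by apply: continuous_add => //; apply: continuous_mul => //; exact: continuous_cst.
- by apply: (continuous_scaled_marginal (f := gain 11)); exact: continuous_gain.
Qed.

End Growth.

(** * Small ball estimate *)

(** A polynomial with [k] coefficients that is small at [k] of the points
    [0, ..., N - 1] has small coefficients: invert the Vandermonde matrix of these
    points, and let the constant run over all choices of them. *)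
Lemma Vandermonde_bound (R : realType) (k N : nat) : exists2 C : R, 0 < C &
  forall (b : 'I_k -> R) (B : R) (J : {set 'I_N}), 0 <= B -> (k <= #|J|)%N ->
  (forall j, j \in J -> `|\sum_(l < k) b l * j%:R ^+ l| <= B) ->
  forall l, `|b l| <= C * B.
Proof.
pose V (f : {ffun 'I_k -> 'I_N}) : 'M[R]_k := Vandermonde k (\row_i (f i)%:R).
pose C f := \sum_i \sum_l `|invmx (V f) i l|.
have C0 f : 0 <= C f by apply: sumr_ge0 => i _; apply: sumr_ge0.
exists (1 + \sum_f C f) => [|b B J B0 kJ hJ l].
  by rewrite ltr_wpDr// sumr_ge0.
pose f := [ffun i : 'I_k => enum_val (widen_ord kJ i)].
have fJ i : f i \in J by rewrite ffunE; exact: enum_valP.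
have finj : injective f.
  move=> i j; rewrite !ffunE => /enum_val_inj/(congr1 val) /= ?.
  exact: val_inj.
have Vu : V f \in unitmx.
  rewrite unitmxE det_Vandermonde unitfE; apply/prodf_neq0 => i _.
  apply/prodf_neq0 => j ij; rewrite !mxE subr_eq0 eqr_nat.
  apply/negP => /eqP /val_inj /finj ji; by rewrite ji ltnn in ij.
have bE : b l = ((\row_l b l) *m V f *m invmx (V f)) 0 l.
  by rewrite mulmxK// mxE.
rewrite bE mxE (le_trans (ler_norm_sum _ _ _))//.
apply: (@le_trans _ _ (C f * B)); last first.
  rewrite ler_wpM2r// (bigD1 f)//= addrCA lerDl addr_ge0// sumr_ge0//.
rewrite mulr_suml; apply: ler_sum => i _; rewrite normrM mulrC.
apply: ler_pM => //.
  by rewrite (bigD1 l)//= lerDl sumr_ge0.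
rewrite mxE (eq_bigr (fun l => b l * (f i)%:R ^+ l)); first exact: hJ.
by move=> l' _; rewrite !mxE.
Qed.

Section SmallBall.
Context {R : realType}.

Lemma card_ord_lt (n k : nat) : (k <= n)%N -> #|[set i : 'I_n | (i < k)%N]%SET| = k.
Proof.
move=> kn; have winj : injective (widen_ord kn).
  by move=> i j /(congr1 val) /= ij; exact: val_inj.
rewrite -[RHS]card_ord -(card_imset predT winj).
apply: eq_card => i; rewrite inE; apply/idP/imsetP => [ik|[j _ ->]]; last exact: (ltn_ord j).
by exists (Ordinal ik) => //; exact: val_inj.
Qed.

(** A point of the moment curve in the space of the first [k] axes. *)
Definition moment_vector (n k j : nat) : 'rV[R]_n :=
  \row_i (if (i < k)%N then j%:R ^+ i else 0).

Lemma dotv_moment_vector (n k j : nat) (v : 'rV[R]_n) :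
  dotv v (moment_vector n k j) =
  \sum_(l < k) (\sum_(i < n | i == l :> nat) v 0 i) * j%:R ^+ l.
Proof.
under [RHS]eq_bigr do rewrite mulr_suml.
rewrite (exchange_big_dep predT) //=; apply: eq_bigr => i _; rewrite mxE.
case: ifPn => [ik|ki].
  rewrite (big_pred1 (Ordinal ik)) => [//|l]; rewrite /= eq_sym.
  by apply/eqP/eqP => [h|->//]; exact: val_inj.
rewrite mulr0 big_pred0 => [//|l]; apply/negP => /eqP il.
by rewrite il ltn_ord in ki.
Qed.

Lemma moment_vector_bounds (n k M j : nat) : (0 < n)%N -> (0 < k)%N -> (j < M)%N ->
  1 <= dotv (moment_vector n k j) (moment_vector n k j) <= k%:R * M%:R ^+ (2 * k).
Proof.
move=> n0 k0 jM; have M1 : 1 <= (M%:R : R) by rewrite ler1n (leq_ltn_trans _ jM).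
apply/andP; split.
  rewrite /dotv (bigD1 (Ordinal n0))//= !mxE /= k0 expr0 mulr1 lerDl.
  by apply: sumr_ge0 => i _; rewrite -expr2 sqr_ge0.
have card_le : (#|[set i : 'I_n | (i < k)%N]%SET| <= k)%N.
  have [kn|nk] := leqP k n; first by rewrite card_ord_lt.
  by rewrite (leq_trans (max_card _))// card_ord ltnW.
apply: (@le_trans _ _ (#|[set i : 'I_n | (i < k)%N]%SET|%:R * M%:R ^+ (2 * k))); last first.
  by rewrite ler_wpM2r ?exprn_ge0// ler_nat.
rewrite mulr_natl -sumr_const [leRHS]big_mkcond; apply: ler_sum => i _.
rewrite !mxE inE; case: ifPn => [ik|_]; last by rewrite mulr0.
rewrite -exprD addnn -mul2n (@le_trans _ _ (M%:R ^+ (2 * i)))//.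
  by rewrite lerXn2r ?nnegrE// ler_nat ltnW.
by rewrite ler_weXn2l// leq_mul2l ltnW.
Qed.

(** Among the [M] points of the moment curve, less than [k] are nearly
    orthogonal to a vector with a sizeable coordinate among the first [k]. Hence,
    once the mass of these coordinates is known to be close to its mean, which
    holds up to a probability [O(1 / k)], a fraction [k / M] of the directions
    give a small product. *)
Lemma mean_tent (beta : R) : 0 < beta -> exists2 s : R, 0 < s &
  forall (n : nat) (mu : probability (borelRV R n) R) (u : 'rV[R]_n),
  uniform_on_sphere mu -> (0 < n)%N -> dotv u u = 1 ->
  mean mu (fun x => tent s (Num.sqrt n%:R * dotv x u)) <= beta.
Proof.
move=> b0; pose k := (Num.bound (32 / beta)).+1.
have kb : 16 / k%:R <= beta / 2.
  rewrite ler_pdivrMr ?ltr0n// -ler_pdivrMl ?divr_gt0//.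
  have := archi_boundP (divr_ge0 (ler0n R 32) (ltW b0)).
  rewrite /k -natr1; set B := (Num.bound _)%:R => h.
  by rewrite (_ : (beta / 2)^-1 * 16 = 32 / beta); [lra|field; rewrite gt_eqF].
pose M := (Num.bound (4 * k%:R / beta)).+1.
have Mb : 2 * k%:R / M%:R <= beta / 2.
  rewrite ler_pdivrMr ?ltr0n// -ler_pdivrMl ?divr_gt0//.
  have := archi_boundP (divr_ge0 (mulr_ge0 (ler0n R 4) (ler0n R k)) (ltW b0)).
  rewrite /M -natr1; set B := (Num.bound _)%:R => h.
  by rewrite (_ : (beta / 2)^-1 * (2 * k%:R) = 4 * k%:R / beta); [lra|field; rewrite gt_eqF].
have kpos : (0 < k)%N by [].
have Mpos : (0 < M)%N by [].
clearbody M k.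
have [C C0 hC] := Vandermonde_bound R k M.
have M0 : 0 < (M%:R : R) by rewrite ltr0n.
have k0 : 0 < (k%:R : R) by rewrite ltr0n.
pose G : R := Num.sqrt (k%:R * M%:R ^+ (2 * k)).
have G0 : 0 < G by rewrite sqrtr_gt0 mulr_gt0// exprn_gt0.
exists (4 * C * G)^-1 => [|n mu u muU n0 u1]; first by rewrite invr_gt0 !mulr_gt0.
set s := (4 * C * G)^-1; have s0 : 0 < s by rewrite invr_gt0 !mulr_gt0.
set N := Num.sqrt (n%:R : R); have Np : 0 < N by rewrite sqrtr_gt0 ltr0n.
have np : 0 < (n%:R : R) by rewrite ltr0n.
have N2 : N ^+ 2 = n%:R by rewrite sqr_sqrtr// ltW.
pose rho (j : nat) := Num.sqrt (dotv (moment_vector n k j) (moment_vector n k j)).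
have rhoP (j : 'I_M) : 0 < rho j <= G.
  have /andP[h1 h2] := moment_vector_bounds n0 kpos (ltn_ord j).
  by rewrite sqrtr_gt0 (lt_le_trans ltr01 h1)/= ler_wsqrtr.
pose z (j : 'I_M) := (rho j)^-1 *: moment_vector n k j.
have z1 j : dotv (z j) (z j) = 1.
  have /andP[h _] := rhoP j; rewrite dotvZl dotvZr mulrA -invfM -expr2.
  rewrite sqr_sqrtr ?dotv_ge0// mulVf//.
  by move: h; rewrite sqrtr_gt0 => h; rewrite gt_eqF.
pose A := [set i : 'I_n | (i < k)%N]%SET.
have A0 : (0 < #|A|)%N by apply/card_gt0P; exists (Ordinal n0); rewrite inE.
have a0 : 0 < (#|A|%:R : R) by rewrite ltr0n.
pose W (x : 'rV[R]_n) := n%:R / #|A|%:R * \sum_(i in A) x 0 i ^+ 2.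
have pw x : dotv x x = 1 -> \sum_(j < M) tent s (N * dotv x (z j)) <=
    8 * M%:R * (W x - 1) ^+ 2 + 2 * k%:R.
  move=> x1; have [Wle|Wgt] := leP (W x) (1 / 2).
    apply: (@le_trans _ _ (\sum_(j < M) 2)); first by apply: ler_sum => j _; exact: tent_le2.
    rewrite sumr_const card_ord -[leLHS]mulr_natl.
    have : 1 / 4 <= (W x - 1) ^+ 2 by nra.
    by nra.
  pose J := [set j : 'I_M | `|N * dotv x (z j)| < 2 * s]%SET.
  have Jk : (#|J| < k)%N.
    rewrite ltnNge; apply/negP => kJ.
    pose b (l : 'I_k) := \sum_(i < n | i == l :> nat) x 0 i.
    have hb := hC (fun l => N * b l) (2 * s * G) J _ kJ.
    have {}hb l : `|N * b l| <= 1 / 2.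
      have := hb _ _ l; rewrite (_ : C * (2 * s * G) = 1 / 2); last first.
        by rewrite /s; field; rewrite !gt_eqF.
      apply; first by rewrite !mulr_ge0// ltW.
      move=> j; rewrite inE => hj; have /andP[r0 rG] := rhoP j.
      rewrite (_ : \sum_l _ = N * dotv x (moment_vector n k j)); last first.
        rewrite dotv_moment_vector mulr_sumr.
        by apply: eq_bigr => l' _; rewrite mulrA.
      rewrite (_ : moment_vector n k j = rho j *: z j); last first.
        by rewrite scalerA mulfV ?scale1r// gt_eqF.
      rewrite dotvZr mulrCA normrM (gtr0_norm r0) mulrC ler_pM// ltW//.
    suff : W x <= 1 / 4 by lra.
    rewrite /W mulrAC -ler_pdivlMr ?invr_gt0// mulr_sumr invrK mulr_natr -sumr_const.
    apply: ler_sum => i; rewrite inE => ik.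
    have := hb (Ordinal ik); rewrite /b /=.
    rewrite (big_pred1 i) => [|i']; last by apply/eqP/eqP => [h|->//]; exact: val_inj.
    move=> h; have := @lerXn2r R 2 `|N * x 0 i| (1 / 2).
    rewrite !nnegrE => /(_ (normr_ge0 _)); rewrite real_normK ?num_real// exprMn N2 => h2.
    by have := h2 _ h; rewrite expr_div_n; lra.
  rewrite (bigID (mem J)) /= [X in _ + X]big1 ?addr0; last first.
    by move=> j; rewrite inE -leNgt => h; rewrite tent_eq0.
  apply: (@le_trans _ _ (\sum_(j in J) 2)); first by apply: ler_sum => j _; exact: tent_le2.
  rewrite sumr_const -[leLHS]mulr_natl.
  have : (#|J|%:R : R) <= k%:R by rewrite ler_nat ltnW.
  have := mulr_ge0 (ltW M0) (sqr_ge0 (W x - 1)); lra.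
have cblock : continuous (fun x : 'rV[R]_n => \sum_(i in A) x 0 i ^+ 2).
  by apply: continuous_bigsum => i; exact: continuous_coord_exp.
have cblock2 : continuous (fun x : 'rV[R]_n => (\sum_(i in A) x 0 i ^+ 2) ^+ 2).
  by apply: (continuous_fun_comp (h := fun y : R => y ^+ 2)) => //; exact: exprn_continuous.
have cmul (c : R) (f : 'rV[R]_n -> R) : continuous f -> continuous (fun x => c * f x).
  by move=> cf; apply: continuous_mul => //; exact: continuous_cst.
pose q : R := n%:R / #|A|%:R.
have WE : (fun x => 8 * M%:R * (W x - 1) ^+ 2 + 2 * k%:R) =
  (fun x => 8 * M%:R * q ^+ 2 * (\sum_(i in A) x 0 i ^+ 2) ^+ 2 +
     ((- (16 * M%:R * q)) * (\sum_(i in A) x 0 i ^+ 2) + (8 * M%:R + 2 * k%:R))).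
  by apply/funext => x; rewrite /W -/q; ring.
have m1 : mean mu (fun x => \sum_(i in A) x 0 i ^+ 2) = #|A|%:R / n%:R.
  rewrite (mean_sum muU); last by move=> i; exact: continuous_coord_exp.
  rewrite (eq_bigr (fun=> n%:R^-1)) => [|i _].
    by rewrite sumr_const -[LHS]mulr_natl.
  have := mean_marginal_sqr muU (dotv_delta_unit i).
  rewrite (_ : (fun x => _) = (fun x : 'rV[R]_n => x 0 i ^+ 2)); last first.
    by apply/funext => x; rewrite dotv_delta.
  by move/(canRL (mulKf _)); rewrite mulr1; apply; rewrite gt_eqF.
have m2 := mean_block_sqr muU A n0.
have tot : M%:R * mean mu (fun x => tent s (N * dotv x u)) <=
    8 * M%:R * (2 / k%:R) + 2 * k%:R.
  have ct j : continuous (fun x => tent s (N * dotv x (z j))).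
    by apply: (continuous_scaled_marginal (f := tent s)); exact: continuous_tent.
  have -> : M%:R * mean mu (fun x => tent s (N * dotv x u)) =
      mean mu (fun x => \sum_(j < M) tent s (N * dotv x (z j))).
    rewrite (mean_sum muU)// -[X in X%:R](card_ord M) mulr_natl -sumr_const.
    apply: eq_bigr => j _; apply: (mean_marginal muU (g := fun y => tent s (N * y))) => //.
    apply: continuous_fun_comp; first exact: continuous_tent.
    by apply: continuous_mul; [exact: continuous_cst|move=> y; exact: cvg_id].
  apply: (@le_trans _ _ (mean mu (fun x => 8 * M%:R * (W x - 1) ^+ 2 + 2 * k%:R))).
    apply: (le_mean muU) => //; first exact: continuous_bigsum.
    rewrite WE; apply: continuous_add; first exact: cmul.
    by apply: continuous_add; [exact: cmul|exact: continuous_cst].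
  rewrite WE (meanD muU); [|exact: cmul|]; last first.
    by apply: continuous_add; [exact: cmul|exact: continuous_cst].
  rewrite (meanD muU); [|exact: cmul|exact: continuous_cst].
  rewrite !(meanZ muU)// (mean_cst muU) m1 m2 addrA addrA lerD2r.
  have Ak : (#|A| = n \/ #|A| = k) /\ (#|A| <= n)%N.
    split; last by rewrite -[leqRHS](card_ord n) max_card.
    have [nk|kn] := leqP n k; last by right; rewrite card_ord_lt// ltnW.
    left; rewrite -[RHS](card_ord n); apply: eq_card => i; rewrite !inE.
    by rewrite (leq_trans (ltn_ord i)).
  rewrite (_ : _ + _ = 8 * M%:R * (2 * (n%:R - #|A|%:R) / (#|A|%:R * (n%:R + 2)))); last first.
    by rewrite /q; field; rewrite !gt_eqF// addr_gt0.
  rewrite ler_wpM2l ?mulr_ge0//; case: Ak => [[->|->] An].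
    by rewrite subrr mulr0 mul0r divr_ge0.
  rewrite -mulrA ler_wpM2l// invfM mulrCA ler_piMr ?invr_ge0//.
  by rewrite ler_pdivrMr ?addr_gt0// mul1r; lra.
rewrite -(ler_pM2l M0); apply: (le_trans tot).
have -> : 8 * M%:R * (2 / k%:R) + 2 * k%:R = M%:R * (16 / k%:R + 2 * k%:R / M%:R) :> R.
  by field; rewrite !gt_eqF.
by rewrite ler_wpM2l//; lra.
Qed.

End SmallBall.

(** * Independent samples *)

Section Independence.
Context {d : measure_display} {T : measurableType d} {R : realType} (P : probability T R).
Context {d' : measure_display} {U : measurableType d'}.

Import HBNNSimple.

Let integral_indep_nnsfun (W : T -> R) (X : T -> U) (c : R) (h : {nnsfun U >-> R}) :
  measurable_fun setT W -> (forall w, 0 <= W w) -> measurable_fun setT X ->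
  (forall B, measurable B -> (\int[P]_w (W w * \1_B (X w))%:E = c%:E * P (X @^-1` B))%E) ->
  (\int[P]_w (W w * h (X w))%:E =
    \sum_(k \in range h) (k%:E * (c%:E * P (X @^-1` (h @^-1` [set k])))))%E.
Proof.
move=> mW W0 mX H.
have mWB B : measurable B -> measurable_fun setT (fun w => W w * \1_B (X w)).
  by move=> mB; apply: measurable_funM => //; apply: (measurableT_comp _ mX).
transitivity (\int[P]_w (\sum_(k \in range h)
    (k * (W w * \1_(h @^-1` [set k]) (X w)))%:E))%E.
  apply: eq_integral => w _; rewrite fsumEFin//; congr EFin.
  rewrite {1}(fimfunE h) mulr_fsumr//.
  by apply: eq_fsbigr => k _; rewrite mulrCA.
rewrite ge0_integral_fsum//.
- apply: eq_fsbigr => k /set_mem [y _ hy].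
  have k0 : 0 <= k by rewrite -hy.
  under eq_integral do rewrite EFinM.
  rewrite ge0_integralZl//.
  + by rewrite H.
  + by apply/measurable_EFinP; exact: mWB.
  + by move=> w _; rewrite lee_fin mulr_ge0.
- by move=> k; apply/measurable_EFinP; apply: measurable_funM => //; exact: mWB.
- move=> k w _; rewrite lee_fin mulrCA mulr_ge0//.
  have := nnfun_muleindic_ge0 h k (X w).
  by rewrite -lee_fin EFinM.
Qed.

(** If [W] is independent of [X] in the weak sense that [W] has the same mean
    [c] conditionally on each event [X \in B], then it factors out of the
    integral of any nonnegative function of [X]. *)
Lemma integral_indep (W : T -> R) (X : T -> U) (c : R) (g : U -> R) :
  measurable_fun setT W -> (forall w, 0 <= W w) -> measurable_fun setT X ->
  0 <= c -> measurable_fun setT g -> (forall y, 0 <= g y) ->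
  (forall B, measurable B -> (\int[P]_w (W w * \1_B (X w))%:E = c%:E * P (X @^-1` B))%E) ->
  (\int[P]_w (W w * g (X w))%:E = c%:E * \int[P]_w (g (X w))%:E)%E.
Proof.
move=> mW W0 mX c0 mg g0 H.
have mgE : measurable_fun setT (EFin \o g) by exact/measurable_EFinP.
pose f := nnsfun_approx measurableT mgE.
have simple n : (\int[P]_w (W w * f n (X w))%:E = c%:E * \int[P]_w (f n (X w))%:E)%E.
  rewrite (integral_indep_nnsfun (f n) mW W0 mX H).
  have H1 B : measurable B -> (\int[P]_w ((fun=> 1) w * \1_B (X w))%:E = 1%:E * P (X @^-1` B))%E.
    move=> mB; under eq_integral do rewrite mul1r.
    rewrite mul1e -[X in P X]setIT -integral_indic//.
    by rewrite -[X in measurable X]setTI; exact: mX.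
  have m1 : measurable_fun setT (fun _ : T => 1 : R) by exact: measurable_cst.
  have := integral_indep_nnsfun (f n) m1 (fun=> ler01) mX H1.
  under eq_integral do rewrite mul1r.
  move=> ->; rewrite ge0_mule_fsumr => [|k].
    by apply: eq_fsbigr => k _; rewrite mul1e muleCA.
  have [k0|k0] := leP 0 k; first by rewrite mul1e mule_ge0// lee_fin.
  rewrite mul1e preimage_nnfun0// preimage_set0 measure0 mule0//.
have cvgf y : (EFin \o f^~ y) @ \oo --> (g y)%:E.
  by apply: (cvg_nnsfun_approx measurableT mgE) => // x _; rewrite lee_fin.
have ndf y : {homo f^~ y : m n / (m <= n)%N >-> m <= n}.
  by move=> m n mn; exact/lefP/nd_nnsfun_approx.
transitivity (limn (fun n => \int[P]_w (W w * f n (X w))%:E)%E).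
  rewrite -monotone_convergence//.
  - apply: eq_integral => w _; apply/esym/cvg_lim => //.
    by under eq_fun do rewrite EFinM; rewrite EFinM; apply: cvgeZl => //; exact: cvgf.
  - move=> n; apply/measurable_EFinP; apply: measurable_funM => //.
    by apply: measurableT_comp mX.
  - by move=> n w _; rewrite lee_fin mulr_ge0.
  - by move=> w _ m n mn; rewrite lee_fin ler_wpM2l//; exact: ndf.
rewrite [X in limn X](_ : _ = (fun n => c%:E * \int[P]_w (f n (X w))%:E)%E); last first.
  by apply/funext => n; exact: simple.
rewrite limeMl//.
  congr (_ * _)%E; rewrite -monotone_convergence//.
  - by apply: eq_integral => w _; apply/cvg_lim => //; exact: cvgf.
  - move=> n; apply/measurable_EFinP.
    by apply: measurableT_comp mX.
  - by move=> n w _; rewrite lee_fin.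
  - by move=> w _ m n mn; rewrite lee_fin; exact: ndf.
have mfX n : measurable_fun setT (fun w => (f n (X w))%:E).
  by apply/measurable_EFinP; apply: measurableT_comp mX.
apply: ereal_nondecreasing_is_cvgn => m n mn; apply: ge0_le_integral => //.
- by move=> w _; rewrite lee_fin.
- by move=> w _; rewrite lee_fin; exact: ndf.
Qed.

(** Independence gives the product rule when all factors are indicator functions;
    [integral_indep] replaces these by arbitrary functions one factor at a time. *)
Lemma integral_prod_indep (m : nat) (X : 'I_m -> T -> U) (g : 'I_m -> U -> R) (e : 'I_m -> R) :
  (forall i, measurable_fun setT (X i)) -> mutually_independent P measurable X ->
  (forall i, measurable_fun setT (g i)) -> (forall i y, 0 <= g i y) ->
  (forall i, (\int[P]_w (g i (X i w))%:E = (e i)%:E)%E) ->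
  (\int[P]_w (\prod_i g i (X i w))%:E = (\prod_i e i)%:E)%E.
Proof.
move=> mX ind mg g0 eg.
have e0 i : 0 <= e i.
  by rewrite -lee_fin -eg integral_ge0// => w _; rewrite lee_fin.
have mgX i : measurable_fun setT (fun w => g i (X i w)) by apply: measurableT_comp (mX i).
have mpre i B : measurable B -> measurable (X i @^-1` B).
  by move=> mB; rewrite -[X in measurable X]setTI; exact: mX.
have m1 i B : measurable B -> measurable_fun setT (fun w => \1_B (X i w) : R).
  by move=> mB; apply: (measurableT_comp _ (mX i)).
pose p i B : R := fine (P (X i @^-1` B)).
have pE i B : measurable B -> P (X i @^-1` B) = (p i B)%:E.
  by move=> mB; rewrite fineK// fin_num_measure//; exact: mpre.
have main s : forall t B, uniq (s ++ t) -> (forall i, measurable (B i)) ->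
  (\int[P]_w (\prod_(i <- s) g i (X i w) * \prod_(i <- t) \1_(B i) (X i w))%:E =
   (\prod_(i <- s) e i * \prod_(i <- t) p i (B i))%:E)%E.
  elim: s => [|i s IH] t B /= ut mB.
    under eq_integral do rewrite big_nil mul1r.
    rewrite big_nil mul1r -prodEFin -(eq_bigr _ (fun i _ => pE i _ (mB i))) -ind//.
    rewrite -[X in P X]setIT -integral_indic//; last first.
      by apply: bigsetI_measurable => i _; exact: mpre.
    apply: eq_integral => w _; congr EFin.
    elim: (t) => [|i t' IHt]; first by rewrite !big_nil indicT.
    by rewrite !big_cons indicI IHt.
  have /andP[ist us] := ut.
  pose W w := \prod_(j <- s) g j (X j w) * \prod_(j <- t) \1_(B j) (X j w).
  pose c := \prod_(j <- s) e j * \prod_(j <- t) p j (B j).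
  have H B0 : measurable B0 ->
      (\int[P]_w (W w * \1_B0 (X i w))%:E = c%:E * P (X i @^-1` B0))%E.
    move=> mB0; pose B' j := if j == i then B0 else B j.
    have B't j : j \in t -> B' j = B j.
      move=> jt; rewrite /B'; case: eqP => // ji.
      by move: ist; rewrite mem_cat -ji jt orbT.
    have B'i : B' i = B0 by rewrite /B' eqxx.
    have := IH (i :: t) B'; rewrite -cat1s uniq_catCA /= => /(_ ut) h.
    have {}h := h (fun j => ltac:(by rewrite /B'; case: ifP)).
    rewrite pE// -EFinM /c; move: h; rewrite big_cons B'i.
    have -> : \prod_(j <- t) p j (B' j) = \prod_(j <- t) p j (B j).
      by apply: eq_big_seq => j jt; rewrite B't.
    rewrite [p i B0 * _]mulrC mulrA => <-.
    apply: eq_integral => w _; rewrite /W big_cons B'i; congr EFin.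
    have -> : \prod_(j <- t) \1_(B' j) (X j w) = \prod_(j <- t) \1_(B j) (X j w) :> R.
      by apply: eq_big_seq => j jt; rewrite B't.
    by rewrite mulrCA mulrC.
  have := @integral_indep W (X i) c (g i) _ _ (mX i) _ (mg i) (g0 i) H.
  rewrite eg -EFinM /c => h.
  transitivity (\int[P]_w (W w * g i (X i w))%:E)%E.
    by apply: eq_integral => w _; rewrite big_cons /W -mulrA mulrC.
  rewrite h.
  - by congr EFin; rewrite big_cons -[RHS]mulrA [RHS]mulrC.
  - apply: measurable_funM.
      by apply: measurable_prod => j _; exact: mgX.
    by apply: measurable_prod => j _; exact: m1.
  - by move=> w; rewrite mulr_ge0// prodr_ge0.
  - by rewrite mulr_ge0// prodr_ge0// => j _; rewrite fine_ge0.
have := main (index_enum 'I_m) [::] (fun=> setT).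
rewrite cats0 index_enum_uniq => /(_ isT (fun=> measurableT)).
rewrite big_nil mulr1 => <-.
by apply: eq_integral => w _; rewrite big_nil mulr1.
Qed.

End Independence.

Section Samples.
Context {R : realType} {d : measure_display} {T : measurableType d} (P : probability T R).
Context {n m : nat} (a : 'I_m -> {RV P >-> borelRV R n}).
Hypothesis a_indep : mutually_independent P (@measurable _ (borelRV R n))
  (fun i => a i : T -> borelRV R n).
Hypothesis a_unif : forall i, uniform_on_sphere (distribution P (a i)).
Hypothesis n_gt0 : (0 < n)%N.

Let N := Num.sqrt (n%:R : R).

Lemma integral_sample i (g : 'rV[R]_n -> R) : continuous g -> (forall x, 0 <= g x) ->
  (\int[P]_w (g (a i w))%:E = (mean (distribution P (a i)) g)%:E)%E.
Proof.
move=> cg g0; have muU := a_unif i; set mu := distribution P (a i) in muU *.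
have mg : measurable_fun [set: borelRV R n] (fun x : borelRV R n => (g x)%:E).
  by apply/measurable_EFinP; exact: continuous_measurable_rV.
transitivity (\int[mu]_x (g x)%:E)%E.
  by rewrite [RHS]ge0_integral_pushforward// => x _; rewrite lee_fin.
have mS := @measurable_unit_sphere R n.
have nullC : mu (~` (@unit_sphere R n)) = 0%E.
  apply: (eq_trans (probability_setC (distribution P (a i)) mS)).
  by rewrite [X in (_ - X)%E](proj1 muU) subee.
rewrite (ge0_negligible_integral (measurableC mS))//; last by move=> x _; rewrite lee_fin.
rewrite setTD setCK /mean /Rintegral fineK//.
exact: (integrable_fin_num mS (integrable_sphere muU cg)).
Qed.

Lemma measurable_sample i (g : 'rV[R]_n -> R) : continuous g ->
  measurable_fun [set: T] (fun w => g (a i w)).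
Proof.
move=> cg; apply: (measurableT_comp (continuous_measurable_rV cg)).
exact: measurable_funPT.
Qed.

Lemma measurable_sum_lt (g : 'rV[R]_n -> R) (c : R) : continuous g ->
  measurable [set w | \sum_i g (a i w) < c].
Proof.
move=> cg; have mF : measurable_fun setT (fun w => \sum_i g (a i w)).
  by apply: measurable_sum => i; exact: measurable_sample.
rewrite (_ : [set w | _] = setT `&` (fun w => \sum_i g (a i w)) @^-1` `]-oo, c[%classic).
  by apply: mF => //; exact: measurable_itv.
by rewrite setTI; apply/seteqP; split=> w /=; rewrite in_itv.
Qed.

(** The exponential Chernoff bound: independence turns the exponential moment of the
    sum into a product, each factor of which is bounded by [mean_expR_growth]. *)
Lemma sample_concentration (D mean_lb eta lam : R) (f : R -> R) (u : 'rV[R]_n) :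
  0 < D -> continuous f -> (forall y, `|f y| <= D * (1 + y ^+ 2)) ->
  0 <= lam <= (64 * D)^-1 -> dotv u u = 1 ->
  (forall i, mean_lb <= mean (distribution P (a i)) (fun x => f (N * dotv x u))) ->
  (P [set w | (\sum_i f (N * dotv (a i w) u) < (mean_lb - eta) * m%:R)%R] <=
    (expR (m%:R * (- (lam * eta) + lam ^+ 2 * growth_const D)))%:E)%E.
Proof.
move=> D0 cf fD lamD u1 hm; set c := (mean_lb - eta) * m%:R.
pose g (x : 'rV[R]_n) := f (N * dotv x u).
have cg : continuous g by apply: (continuous_scaled_marginal (f := f)).
pose h (x : 'rV[R]_n) := expR (- (lam * g x)).
have ch : continuous h.
  apply: (continuous_fun_comp (h := @expR R) (f := fun x => - (lam * g x))).
    exact: continuous_expR.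
  under eq_fun do rewrite -mulNr.
  by apply: continuous_mul => //; exact: continuous_cst.
have h0 x : 0 <= h x by exact: expR_ge0.
have mA := measurable_sum_lt c cg.
have prodE : (\int[P]_w (\prod_i h (a i w))%:E =
    (\prod_i mean (distribution P (a i)) h)%:E)%E.
  apply: (integral_prod_indep (X := fun i => a i : T -> borelRV R n)
    (g := fun _ => (h : borelRV R n -> R))) => //.
  - by move=> i; exact: continuous_measurable_rV.
  - by move=> i; exact: integral_sample.
have mprod : measurable_fun setT (fun w => \prod_i h (a i w)).
  by apply: measurable_prod => i _; exact: measurable_sample.
apply: (@le_trans _ _ (\int[P]_w ((expR (lam * c))%:E * (\prod_i h (a i w))%:E))%E).
  rewrite -[X in P X]setIT -integral_indic//; apply: ge0_le_integral => //.
  - by apply/measurable_EFinP.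
  - by apply: emeasurable_funM => //; apply/measurable_EFinP.
  move=> w _; rewrite -EFinM lee_fin indicE; case: (boolP (w \in _)) => [|_]; last first.
    by rewrite mulr_ge0 ?expR_ge0// prodr_ge0.
  rewrite inE /= => /ltW hw.
  rewrite -(big_morph (@expR R) (@expRD R) (@expR0 R)) -expRD -[leLHS]expR0 ler_expR.
  by rewrite sumrN -mulr_sumr subr_ge0 ler_wpM2l//; case/andP: lamD.
rewrite ge0_integralZl//; last 2 first.
- by apply/measurable_EFinP.
- by move=> w _; rewrite lee_fin prodr_ge0.
rewrite prodE -EFinM lee_fin.
apply: (@le_trans _ _ (expR (lam * c) * \prod_(i < m) expR (- (lam * mean_lb) + lam ^+ 2 * growth_const D))).
  rewrite ler_wpM2l ?expR_ge0//; apply: ler_prod => i _; apply/andP; split.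
    rewrite -[leLHS](mean_cst (a_unif i)); apply: (le_mean (a_unif i)) => //.
    exact: continuous_cst.
  exact: (mean_expR_growth (a_unif i) n_gt0).
rewrite prodr_const card_ord -expRM_natl -expRD ler_expR /c.
by rewrite le_eqVlt; apply/orP; left; apply/eqP; ring.
Qed.

Lemma negligible_off_sphere : P (\big[setU/set0]_(i <- enum 'I_m) (a i @^-1` (~` @unit_sphere R n))) = 0%E.
Proof.
apply/eqP; rewrite -measure_le0.
have mi i : measurable (a i @^-1` (~` @unit_sphere R n : set (borelRV R n))).
  rewrite -[X in measurable X]setTI; apply: measurable_funPT => //.
  by apply: measurableC; exact: measurable_unit_sphere.
apply: le_trans (measure_bigsetU_seq_le _ _ mi) _; rewrite big1// => i _.
have mS := @measurable_unit_sphere R n.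
have := @probability_setC _ _ _ (distribution P (a i)) _ mS.
by rewrite [X in (_ = _ - X)%E](proj1 (a_unif i)) subee.
Qed.

End Samples.

(** A small [lam] makes the term quadratic in [lam] at most half the linear one. *)
Lemma exists_concentration_rate (R : realType) (D eta : R) : 0 < D -> 0 < eta ->
  exists2 kappa : R, 0 < kappa & exists2 lam : R, 0 <= lam <= (64 * D)^-1 &
    - (lam * eta) + lam ^+ 2 * growth_const D <= - kappa.
Proof.
move=> D0 e0; have K0 := growth_const_gt0 D0.
pose lam := Num.min (64 * D)^-1 (eta / (2 * growth_const D)).
have l0 : 0 < lam by rewrite lt_min invr_gt0 divr_gt0 ?mulr_gt0.
exists (lam * eta / 2); first by rewrite divr_gt0// mulr_gt0.
exists lam; first by rewrite (ltW l0) ge_min lexx.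
have : lam * (2 * growth_const D) <= eta.
  by rewrite -ler_pdivlMr ?mulr_gt0// ge_min lexx orbT.
by move=> h; have := ler_wpM2l (ltW l0) h; lra.
Qed.

(** * Convergence of the algorithm *)

Section GoodSample.
Context {R : realType} (s : R) (L : nat).
Hypothesis s_gt0 : 0 < s.
Hypothesis L_large : 60 * 90 + 60 * 100 / s * 100 <= L%:R.
Context {n m : nat} (a : 'I_m -> 'rV[R]_n) (net : seq 'rV[R]_n).
Hypothesis a_unit : forall i, dotv (a i) (a i) = 1.
Hypothesis netP : is_net (2 / L%:R) net.

Let Y i v := Num.sqrt n%:R * dotv (a i) v.

Let beta : R := (100 * 100)^-1.

Hypothesis net_sqr : forall u, u \in net -> (- 1 - beta) * m%:R <= \sum_i - Y i u ^+ 2.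
Hypothesis net_gain : forall u, u \in net -> (9 / 10 - beta) * m%:R <= \sum_i gain 11 (Y i u).
Hypothesis net_tent : forall u, u \in net -> (- beta - beta) * m%:R <= \sum_i - tent s (Y i u).

Let L_gt0 : 0 < (L%:R : R).
Proof.
apply: lt_le_trans L_large; rewrite ltr_pwDl ?mulr_ge0 ?invr_ge0 ?(ltW s_gt0)//.
Qed.

Let quadratic v : \sum_i Y i v ^+ 2 <= 8 * m%:R * dotv v v.
Proof.
apply: (quadratic_bound_net a_unit (s := net)) => [|u us].
  have [nu nd] := netP; split=> // {}v v1; have [u un uv] := nd v v1; exists u => //.
  rewrite (le_trans uv)// lerXn2r ?nnegrE ?divr_ge0 ?(ltW L_gt0)//.
  rewrite ler_pdivrMr//; have := L_large.
  have : 0 <= 60 * 100 / s * 100 by rewrite !mulr_ge0 ?invr_ge0 ?(ltW s_gt0).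
  lra.
have := net_sqr us; rewrite sumrN /beta; have : 0 <= (m%:R : R) by [].
rewrite -/(Y _ _); lra.
Qed.

Let extend f (l c : R) : 0 <= l -> locally_lipschitz l f -> 60 * l <= c * L%:R ->
  forall b, (forall u, u \in net -> b * m%:R <= \sum_i f (Y i u)) ->
  forall v, dotv v v = 1 -> (b - c) * m%:R <= \sum_i f (Y i v).
Proof.
move=> l0 fl lc b hb v v1; have [nu nd] := netP.
have [u un uv] := nd v v1.
have e0 : 0 < 2 / L%:R :> R by rewrite divr_gt0.
apply: le_trans (locally_lipschitz_net e0 l0 fl quadratic (nu u un) v1 uv).
rewrite mulrBl lerB ?hb//.
have h : 30 * l * (2 / L%:R) <= c.
  by rewrite mulrA ler_pdivrMr// (le_trans _ lc)//; lra.
exact: ler_wpM2r.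
Qed.

(** The mesh [2 / L] of the net costs at most [1 / 10] here and [beta] below. *)
Lemma sphere_gain v : dotv v v = 1 -> 7 / 10 * m%:R <= \sum_i gain 11 (Y i v).
Proof.
move=> v1; apply: le_trans (extend (l := 9) (c := 1 / 10) _ (gain_lipschitz 11) _ net_gain v1).
- by rewrite ler_wpM2r// /beta; lra.
- by [].
- have := L_large; have : 0 <= 60 * 100 / s * 100 by rewrite !mulr_ge0 ?invr_ge0 ?(ltW s_gt0).
  lra.
Qed.

Lemma sphere_tent v : dotv v v = 1 ->
  4 * 11 ^+ 2 * \sum_i tent s (Y i v) <= 2 / 10 * m%:R.
Proof.
move=> v1; have si : 0 <= s^-1 by rewrite invr_ge0 ltW.
have := extend (l := s^-1) (c := beta) si (locally_lipschitzN (tent_lipschitz s_gt0)) _ net_tent v1.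
rewrite sumrN => /(_ _) h.
have : 60 * s^-1 <= beta * L%:R.
  by rewrite /beta [leRHS]mulrC ler_pdivlMr ?mulr_gt0//; have := L_large; lra.
move/h; rewrite /beta; have : 0 <= (m%:R : R) by [].
lra.
Qed.

End GoodSample.

Lemma geometric_rate (R : realType) (n K : nat) (eps delta2 : R) : (0 < n)%N ->
  0 < eps -> 0 < delta2 ->
  2 * (ln (1 / eps) + ln (2 / delta2)) * n%:R <= K%:R ->
  (1 - (2 * n%:R)^-1) ^+ K <= eps * (delta2 / 2).
Proof.
move=> n0 e0 d0 hK; have np : 0 < (n%:R : R) by rewrite ltr0n.
have n1 : 1 <= (n%:R : R) by rewrite ler1n.
have q0 : 0 <= 1 - (2 * n%:R)^-1 :> R.
  by rewrite subr_ge0 invf_le1 ?mulr_gt0//; lra.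
have qe : 1 - (2 * n%:R)^-1 <= expR (- (2 * n%:R)^-1) :> R by exact: expR_ge1Dx.
apply: (@le_trans _ _ (expR (- (2 * n%:R)^-1) ^+ K)).
  by rewrite lerXn2r ?nnegrE ?expR_ge0.
rewrite -expRM_natl mulrN.
have -> : eps * (delta2 / 2) = expR (- (ln (1 / eps) + ln (2 / delta2))).
  rewrite opprD expRD !expRN !lnK ?posrE ?divr_gt0//; field.
  by rewrite !gt_eqF.
rewrite ler_expR lerN2 ler_pdivlMr ?mulr_gt0//; move: hK; lra.
Qed.

Section Convergence.
Context {R : realType} (s : R) {n m : nat} (a : 'I_m -> 'rV[R]_n).
Hypothesis s_gt0 : 0 < s.
Hypotheses (n_gt0 : (0 < n)%N) (m_gt0 : (0 < m)%N).
Hypothesis a_unit : forall i, dotv (a i) (a i) = 1.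
Hypothesis a_gain : forall v, dotv v v = 1 ->
  7 / 10 * m%:R <= \sum_(i < m) gain 11 (Num.sqrt n%:R * dotv (a i) v).
Hypothesis a_tent : forall v, dotv v v = 1 ->
  4 * 11 ^+ 2 * \sum_(i < m) tent s (Num.sqrt n%:R * dotv (a i) v) <= 2 / 10 * m%:R.

(** The ball where the contraction holds has squared radius
    [B = (s / 11) ^+ 2 * dotv x x]. The initial error is at most [delta1 * B], so
    that leaving the ball has probability at most [delta1], and the remaining
    failure probability is bounded by Markov's inequality. *)
Lemma kaczmarz_convergence (delta1 delta2 eps : R) (x x0 : 'rV[R]_n) (K : nat)
    (d : measure_display) (T : measurableType d) (P : probability T R) (r : nat -> T -> 'I_m) :
  0 < delta1 -> 0 < delta2 -> norm2 (x0 - x) <= s / 11 * Num.sqrt delta1 * norm2 x -> 0 < eps ->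
  2 * (ln (1 / eps) + ln (2 / delta2)) * n%:R <= K%:R ->
  iid_uniform_indices P r ->
  ((1 - delta1 - delta2)%:E <=
    P [set w | (norm2 (kaczmarz a (fun i => `|dotv (a i) x|%R) (fun k => r k w) x0 K - x) ^+ 2
                <= eps * norm2 (x0 - x) ^+ 2)%R])%E.
Proof.
move=> d1 d2 hx0 e0 hK riid.
under eq_set do rewrite !sqr_norm2.
set V := dotv (x0 - x) (x0 - x).
have [V0|Vn0] := eqVneq V 0.
  have -> : x0 = x by apply/eqP; rewrite -subr_eq0 -dotv_eq0; apply/eqP.
  rewrite (_ : [set w | _] = setT); last first.
    by apply/seteqP; split=> // w _ /=; rewrite kaczmarz_fix subrr dotv0r V0 mulr0.
  by rewrite probability_setT lee_fin; lra.
have Vp : 0 < V by rewrite lt_def Vn0 dotv_ge0.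
have hV : V <= (s / 11) ^+ 2 * delta1 * dotv x x.
  rewrite /V -!sqr_norm2 -[delta1]sqr_sqrtr ?(ltW d1)// -!exprMn.
  by rewrite lerXn2r ?nnegrE ?norm2_ge0// (le_trans _ hx0)// norm2_ge0.
have xp : 0 < dotv x x.
  rewrite lt_def dotv_ge0 andbT; apply: contraTneq Vp => x0'.
  by rewrite -leNgt (le_trans hV)// x0' mulr0.
pose B := (s / 11) ^+ 2 * dotv x x.
have B0 : 0 < B by rewrite mulr_gt0 ?exprn_gt0 ?divr_gt0.
have n1 : 1 <= (n%:R : R) by rewrite ler1n.
have np : 0 < (2 * n%:R : R) by rewrite mulr_gt0 ?ltr0n.
pose q : R := 1 - (2 * n%:R)^-1.
have q01 : 0 <= q <= 1.
  rewrite subr_ge0 invf_le1// gerBl invr_ge0 (ltW np) andbT; lra.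
have t0 : 0 < eps * V by rewrite mulr_gt0.
apply: le_trans (kaczmarz_success riid m_gt0 q01 B0 t0 _ K x0).
  rewrite lee_fin -addrA lerD2l -opprD lerN2 lerD//.
    by rewrite ler_pdivrMr// mulrCA mulrA.
  rewrite -/V (_ : V / (eps * V) = eps^-1); last by field; rewrite Vn0 gt_eqF.
  rewrite ler_pdivrMr//.
  apply: (le_trans (geometric_rate n_gt0 e0 d2 hK)).
  by rewrite mulrC ler_wpM2r ?(ltW e0)//; lra.
move=> y hy; apply: (kaczmarz_contraction n_gt0 m_gt0 s_gt0 _ a_unit a_gain a_tent) => //.
  by move: hy; rewrite /B expr_div_n; lra.
by rewrite -dotv_gt0.
Qed.

End Convergence.

(** The logarithm of [m / n] is nonnegative once [C >= 1], so the two assumptions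
    give [m >= C * n] and [m >= C * ln (1 / delta)]; half of the exponent pays for
    the net and half for [delta]. *)
Lemma union_bound_rate (R : realType) (A kappa : R) : 1 <= A -> 0 < kappa ->
  exists2 C : R, 0 < C & forall (n m : nat) (delta : R), (1 <= n)%N -> (1 <= m)%N ->
    0 < delta -> C * n%:R <= m%:R ->
    C * (n%:R * ln (m%:R / n%:R) + ln (1 / delta)) <= m%:R ->
    A ^+ n * (3 * expR (- (m%:R * kappa))) <= delta.
Proof.
move=> A1 k0; have lA : 0 <= ln A by exact: ln_ge0.
pose C := 1 + (2 * (ln A + 2) + 2) / kappa.
have Ck : (2 * (ln A + 2) + 2) <= C * kappa.
  have -> : C * kappa = kappa + (2 * (ln A + 2) + 2) by rewrite /C; field; rewrite gt_eqF.
  by rewrite lerDr ltW.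
have C1 : 1 <= C by rewrite /C lerDl divr_ge0 ?(ltW k0)//; lra.
exists C; first lra.
move=> n m delta n0 m0 d0 hn hd.
have np : 0 < (n%:R : R) by rewrite ltr0n.
have n1 : 1 <= (n%:R : R) by rewrite ler1n.
have nm : (n%:R : R) <= m%:R by apply: le_trans hn; rewrite ler_peMl.
have lmn : 0 <= ln (m%:R / n%:R : R) by rewrite ln_ge0// ler_pdivlMr// mul1r.
set l := ln (1 / delta) in hd *.
have hl : C * l <= m%:R.
  apply: le_trans hd; rewrite ler_wpM2l//; first lra.
  by rewrite lerDr mulr_ge0.
have -> : delta = expR (- l) by rewrite /l expRN lnK ?posrE ?divr_gt0// div1r invrK.
have -> : A = expR (ln A) by rewrite lnK// posrE; lra.
have h3 : 3 <= expR (2 * n%:R) :> R.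
  apply: (@le_trans _ _ (expR 2)); first by have := @expR_ge1Dx R 2; lra.
  by rewrite ler_expR; lra.
rewrite -expRM_natl.
apply: (@le_trans _ _ (expR (n%:R * ln A) * (expR (2 * n%:R) * expR (- (m%:R * kappa))))).
  by rewrite ler_wpM2l ?expR_ge0// ler_wpM2r ?expR_ge0.
rewrite -!expRD ler_expR.
have a1 := ler_wpM2r (ltW k0) hn.
have a2 := ler_wpM2r (ltW k0) hl.
have a3 := ler_wpM2r (ltW np) Ck.
have a4 : 2 * l <= C * kappa * l \/ l <= 0.
  have [l0|l0] := leP l 0; [by right|left].
  by rewrite ler_wpM2r ?(ltW l0)//; lra.
have mk : 0 <= m%:R * kappa by rewrite mulr_ge0// ltW.
case: a4 => a4; last by nra.
have : 2 * (ln A + 2) * n%:R <= m%:R * kappa by nra.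
have : 2 * l <= m%:R * kappa by nra.
lra.
Qed.

Section GoodEvent.
Context {R : realType} {d : measure_display} {T : measurableType d} (P : probability T R).
Context {n m : nat} (a : 'I_m -> {RV P >-> borelRV R n}).
Hypothesis a_indep : mutually_independent P (@measurable _ (borelRV R n))
  (fun i => a i : T -> borelRV R n).
Hypothesis a_unif : forall i, uniform_on_sphere (distribution P (a i)).
Hypothesis n_gt0 : (0 < n)%N.

Let Y i w v := Num.sqrt n%:R * dotv (a i w) v.

(** For one direction [u], each of the three sums falls [beta] below its mean with
    exponentially small probability; the event is the complement of the union
    of these failures over the net. *)
Lemma exists_good_event (s beta kappa lam : R) (net : seq 'rV[R]_n) :
  0 < s -> 0 < beta -> 0 <= lam <= (64 * 9)^-1 ->
  - (lam * beta) + lam ^+ 2 * growth_const 9 <= - kappa ->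
  (forall i u, dotv u u = 1 ->
     mean (distribution P (a i)) (fun x => tent s (Num.sqrt n%:R * dotv x u)) <= beta) ->
  (forall u, u \in net -> dotv u u = 1) ->
  exists E : set T, [/\ measurable E,
    ((1 - (size net)%:R * (3 * expR (- (m%:R * kappa))))%:E <= P E)%E &
    forall w, E w -> (forall i, dotv (a i w) (a i w) = 1) /\
      forall u, u \in net ->
      [/\ (- 1 - beta) * m%:R <= \sum_i - Y i w u ^+ 2,
          (9 / 10 - beta) * m%:R <= \sum_i gain 11 (Y i w u) &
          (- beta - beta) * m%:R <= \sum_i - tent s (Y i w u)]].
Proof.
move=> s0 b0 lamP rate htent unet.
pose bad (f : R -> R) (c : R) (u : 'rV[R]_n) := [set w | \sum_i f (Y i w u) < (c - beta) * m%:R].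
pose fsq (y : R) := - y ^+ 2; pose ften (y : R) := - tent s y.
have csq : continuous (fun y : R => y ^+ 2) by exact: exprn_continuous.
have cN (f : R -> R) : continuous f -> continuous (fun y => - f y).
  by move=> cf y; apply: (@continuousN R R^o R f y); exact: cf.
have cfsq : continuous fsq by exact: cN.
have cften : continuous ften by apply: cN; exact: continuous_tent.
have mbad (f : R -> R) c u : continuous f -> measurable (bad f c u).
  move=> cf; apply: (measurable_sum_lt a (g := fun x => f (Num.sqrt n%:R * dotv x u))).
  exact: (continuous_scaled_marginal (f := f)).
have pbad (f : R -> R) c u : continuous f -> (forall y, `|f y| <= 9 * (1 + y ^+ 2)) -> dotv u u = 1 ->
    (forall i, c <= mean (distribution P (a i)) (fun x => f (Num.sqrt n%:R * dotv x u))) ->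
    (P (bad f c u) <= (expR (- (m%:R * kappa)))%:E)%E.
  move=> cf fD u1 hc.
  apply: le_trans (sample_concentration a_indep a_unif n_gt0 beta _ cf fD lamP u1 hc) _ => //.
  by rewrite lee_fin ler_expR -[leRHS]mulrN ler_wpM2l.
pose badu u := bad fsq (- 1) u `|` bad (gain 11) (9 / 10) u `|` bad ften (- beta) u.
have mbadu u : measurable (badu u).
  by apply: measurableU; [apply: measurableU|]; apply: mbad => //; exact: continuous_gain.
have pbadu u : dotv u u = 1 -> (P (badu u) <= (3 * expR (- (m%:R * kappa)))%:E)%E.
  move=> u1.
  have p1 : (P (bad fsq (- 1)%R u) <= (expR (- (m%:R * kappa)))%:E)%E.
    apply: pbad => // [y|i].
      by rewrite normrN ger0_norm ?sqr_ge0//; have := sqr_ge0 y; lra.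
    rewrite (_ : mean _ _ = - 1)//.
    rewrite -[in RHS](mean_scaled_sqr (a_unif i) u1) -[RHS]mulN1r -(meanZ (a_unif i)).
      by congr mean; apply/funext => x; rewrite mulN1r.
    by apply: (continuous_scaled_marginal (f := fun y => y ^+ 2)).
  have p2 : (P (bad (gain 11) (9 / 10)%R u) <= (expR (- (m%:R * kappa)))%:E)%E.
    apply: pbad => // [|y|i]; first exact: continuous_gain.
      rewrite /gain; have y0 := sqr_ge0 y.
      have h0 : 0 <= Num.max 0 (y ^+ 2 - 11 ^+ 2 / 2) by rewrite le_max lexx.
      have h1 : Num.max 0 (y ^+ 2 - 11 ^+ 2 / 2) <= y ^+ 2 by rewrite ge_max y0 gerBl; lra.
      by rewrite ler_norml; apply/andP; split; lra.
    exact: (mean_gain (a_unif i)).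
  have p3 : (P (bad ften (- beta)%R u) <= (expR (- (m%:R * kappa)))%:E)%E.
    apply: pbad => // [y|i].
      rewrite normrN ger0_norm ?tent_ge0//; have := tent_le2 y s0; have := sqr_ge0 y; lra.
    have ct : continuous (fun x : 'rV[R]_n => tent s (Num.sqrt n%:R * dotv x u)).
      by apply: (continuous_scaled_marginal (f := tent s)); exact: continuous_tent.
    rewrite (_ : mean _ _ = - mean (distribution P (a i)) (fun x => tent s (Num.sqrt n%:R * dotv x u))).
      by rewrite lerN2; exact: htent.
    rewrite -mulN1r -(meanZ (a_unif i))//.
    by congr mean; apply/funext => x; rewrite mulN1r.
  have mu1 := mbad _ (- 1) u cfsq; have mu2 := mbad _ (9 / 10) u (@continuous_gain R 11).
  have mu3 := mbad _ (- beta) u cften.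
  apply: le_trans (measureU2 _ (measurableU _ _ mu1 mu2) mu3) _.
  rewrite (_ : 3 * expR (- (m%:R * kappa)) = expR (- (m%:R * kappa)) +
    expR (- (m%:R * kappa)) + expR (- (m%:R * kappa))); last by ring.
  rewrite !EFinD leeD//.
  by apply: le_trans (measureU2 _ mu1 mu2) _; exact: leeD.
pose off := \big[setU/set0]_(i <- enum 'I_m) (a i @^-1` (~` @unit_sphere R n)).
have moff : measurable off.
  apply: bigsetU_measurable => i _; rewrite -[X in measurable X]setTI.
  apply: measurable_funPT => //; apply: measurableC; exact: measurable_unit_sphere.
pose F := off `|` \big[setU/set0]_(u <- net) badu u.
have mnet : measurable (\big[setU/set0]_(u <- net) badu u) by exact: bigsetU_measurable.
have mF : measurable F by exact: measurableU.
exists (~` F); split; first exact: measurableC.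
  rewrite probability_setC// EFinB leeB//.
  apply: le_trans (measureU2 _ moff mnet) _; rewrite [X in (X + _)%E](negligible_off_sphere a_unif) add0e.
  apply: le_trans (measure_bigsetU_seq_le _ _ mbadu) _.
  apply: (@le_trans _ _ (\sum_(u <- net) (3 * expR (- (m%:R * kappa)))%:E)%E).
    by rewrite big_seq [leRHS]big_seq; apply: lee_sum => u un; apply: pbadu; exact: unet.
  by rewrite sumEFin big_const_seq count_predT iter_addr_0 lee_fin -[leLHS]mulr_natl.
move=> w Ew; split=> [i|u un].
  apply: contrapT => h; apply: Ew; left; rewrite /off -bigcup_seq.
  by exists i; rewrite /= ?mem_enum// unit_sphereE.
have nb : ~ badu u w.
  by move=> bw; apply: Ew; right; rewrite -bigcup_seq; exists u.
split; rewrite leNgt; apply/negP => h; apply: nb.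
- by left; left.
- by left; right.
- by right.
Qed.

End GoodEvent.

Theorem theorem1p2 (R : realType) :
  exists C c : R, 0 < C /\ 0 < c /\
  forall (n m : nat) (delta1 delta delta2 : R),
    (1 <= n)%N -> (1 <= m)%N ->
    0 < delta1 <= 1 / 2 -> 0 < delta <= 1 -> 0 < delta2 <= 1 ->
    C * n%:R <= m%:R ->
    C * (n%:R * ln (m%:R / n%:R) + ln (1 / delta)) <= m%:R ->
  forall (d : measure_display) (T : measurableType d) (P : probability T R)
    (a : 'I_m -> {RV P >-> borelRV R n}),
    mutually_independent P (@measurable _ (borelRV R n))
      (fun i => a i : T -> borelRV R n) ->
    (forall i, uniform_on_sphere (distribution P (a i))) ->
  exists E : set T,
    measurable E /\ ((1 - delta)%:E <= P E)%E /\
    forall w : T, E w ->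
    forall x x0 : 'rV[R]_n,
      norm2 (x0 - x) <= c * Num.sqrt delta1 * norm2 x ->
    forall (eps : R) (K : nat),
      0 < eps ->
      2 * (ln (1 / eps) + ln (2 / delta2)) * n%:R <= K%:R ->
    forall (d' : measure_display) (T' : measurableType d')
      (P' : probability T' R) (r : nat -> T' -> 'I_m),
      iid_uniform_indices P' r ->
      ((1 - delta1 - delta2)%:E <=
         P' [set w' | (norm2 (kaczmarz (fun i => a i w)
                                (fun i => `|dotv (a i w) x|%R)
                                (fun k => r k w') x0 K - x) ^+ 2
                       <= eps * norm2 (x0 - x) ^+ 2)%R])%E.
Proof.
(* With tents of mean [beta], the sums of tents over the sphere are at most
   [3 * beta * m]: one [beta] for the mean, one for the deviation and one for the
   net. The size of [beta] is dictated by [4 * 11 ^+ 2 * (3 * beta) <= 2 / 10]. *)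
pose beta : R := (100 * 100)^-1; have b0 : 0 < beta by rewrite invr_gt0 mulr_gt0.
have [s s0 htent] := mean_tent b0.
have [|kappa k0 [lam lamP rate]] := @exists_concentration_rate R 9 beta _ b0; first by [].
pose X : R := 60 * 90 + 60 * 100 / s * 100.
pose L := (Num.bound X).+2.
have X0 : 0 <= X by rewrite addr_ge0 ?mulr_ge0 ?invr_ge0 ?(ltW s0).
have LX : X <= L%:R.
  rewrite (le_trans (ltW (archi_boundP X0)))// ler_nat.
  exact: leq_trans (leqnSn _) (leqnSn _).
have L1 : (1 < L)%N by [].
clearbody L.
have [|C C0 hC] := @union_bound_rate R (4 * 2 ^ L)%:R kappa _ k0.
  by rewrite ler1n muln_gt0 expn_gt0.
exists C, (s / 11); do !split; [by []|by rewrite divr_gt0|].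
move=> n m delta1 delta delta2 n0 m0 /andP[d1 _] /andP[d0 _] /andP[d2 _] hn hd.
move=> d T P a ind unif.
have [net size_net netP] := @exists_net R L L1 n n0.
have [net_unit _] := netP.
have [E [mE PE hE]] := exists_good_event ind unif n0 s0 b0 lamP rate
  (fun i u => htent n _ u (unif i) n0) net_unit.
exists E; split=> //; split.
  apply: le_trans PE; rewrite lee_fin lerD2l lerN2.
  apply: le_trans (hC n m delta n0 m0 d0 hn hd).
  rewrite ler_wpM2r ?mulr_ge0 ?expR_ge0//.
  by rewrite -natrX ler_nat.
move=> w Ew x x0 hx0 eps K e0 hK d' T' P' r riid.
have [a1 anet] := hE w Ew.
apply: (@kaczmarz_convergence R s n m (fun i => a i w)) => //.
- move=> v; apply: (sphere_gain s0 LX a1 netP) => u un; by case: (anet u un).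
- move=> v; apply: (sphere_tent s0 LX a1 netP) => u un; by case: (anet u un).
Qed.
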